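(* Let $\mathbf{k}$ be an algebraically closed field of characteristic zero. A rigid Stanley-Reisner variety never shares its automorphism ind-group with a non-rigid one: if $\Delta$ and $\Delta'$ are simplicial complexes on $[n]$ and $[n']$ such that $X_\Delta$ is rigid and $X_{\Delta'}$ is non-rigid, then $\operatorname{Aut}(X_\Delta)$ and $\operatorname{Aut}(X_{\Delta'})$ are not isomorphic as ind-groups. In particular: (i) if $\Delta$ is a simplicial complex on $[n]$ with $\operatorname{Aut}(X_\Delta)\cong T_0\rtimes S(\Delta)$ as ind-groups, then $\Delta$ is fully hidden; (ii) no assignment $\Delta\mapsto\Phi(\Delta)$ producing a fully exposed complex $\Phi(\Delta)$ with $\operatorname{Aut}(X_{\Phi(\Delta)})\cong\operatorname{Aut}(X_\Delta)$ (as ind-groups) can be defined on the class of complexes $\Delta$ for which $X_\Delta$ is rigid.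
   Context: $\mathbf{k}$ is an algebraically closed field of characteristic zero. For $n\ge 1$, $[n]=\{1,\dots,n\}$. A simplicial complex $\Delta$ on $[n]$ is a collection of subsets of $[n]$ (faces) closed under taking subsets; it is always assumed that $\{i\}\in\Delta$ for every $i\in[n]$. Facets are the inclusion-maximal faces; $\mathcal F(\Delta)$ is the set of facets, and $\mathcal F_\sigma(\Delta)=\{F\in\mathcal F(\Delta):\sigma\subseteq F\}$ for $\sigma\subseteq[n]$. For a face $S$, $\operatorname{cl}(S)=\bigcap_{F\in\mathcal F_S(\Delta)}F$. For $i\in[n]$, $\mathcal A_i(\Delta)=\{S\subseteq[n]\setminus\{i\}: S\in\Delta,\ i\in\operatorname{cl}(S)\}$. A facet $F$ is exposed if there exist $i\in[n]$ and $S\in\mathcal A_i(\Delta)$ with $S\subseteq F$, and hidden otherwise. $\Delta$ is fully exposed if every facet is exposed, fully hidden if every facet is hidden. Stanley-Reisner variety: $\mathbf k[\Delta]=\mathbf k[x_1,\dots,x_n]/I_\Delta$ with $I_\Delta=(\prod_{i\in\sigma}x_i:\sigma\subseteq[n],\sigma\notin\Delta)$, $X_\Delta=\operatorname{Spec}\mathbf k[\Delta]$, $\overline{x}_i$ the class of $x_i$. $X_\Delta$ is rigid if it admits no nontrivial regular action of the additive group $\mathbb G_{\mathrm a}=(\mathbf k,+)$, and non-rigid otherwise. Ind-varieties and ind-groups: an ind-variety is a set $\mathcal V$ with an ascending filtration $\mathcal V_0\subseteq\mathcal V_1\subseteq\cdots$ with union $\mathcal V$, each $\mathcal V_k$ an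 algebraic variety (not necessarily irreducible) and each inclusion a closed immersion. A morphism $\varphi:\mathcal V\to\mathcal W$ is a map such that for each $k$ there is $\ell$ with $\varphi(\mathcal V_k)\subseteq\mathcal W_\ell$ and $\varphi|_{\mathcal V_k}$ a morphism of varieties. An ind-group is a group with an ind-variety structure for which multiplication and inversion are morphisms. An isomorphism of ind-groups is a group isomorphism that is also an isomorphism of ind-varieties. The group $\operatorname{Aut}(X_\Delta)=\operatorname{Aut}_{\mathbf k}(\mathbf k[\Delta])$ is an ind-group: $\varphi$ is identified with $(\varphi,\varphi^{-1})$, each endomorphism being given by the tuple of images of $\overline x_1,\dots,\overline x_n$, and the $d$-th filtration piece consists of pairs for which $\varphi$ and $\varphi^{-1}$ both send every $\overline{x}_l$ to an element of total degree at most $d$. $T_0=(\mathbf k^* )^n$ is the standard torus; $S(\Delta)\subseteq S_n$ is the group of permutations $\sigma$ of $[n]$ with $\{\sigma(A):A\in\Delta\}=\Delta$; the semidirect product $T_0\rtimes S(\Delta)$ is formed with $S(\Delta)$ permuting the coordinates of $T_0$, and is a linear algebraic group, hence an ind-group. *)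

(* Defs.v *)
From HB Require Import structures.
From mathcomp Require Import all_boot all_order all_fingroup all_algebra.
From mathcomp Require Import generic_quotient ring_quotient boolp.
From mathcomp Require Import freeg mpoly.

Set Implicit Arguments.
Unset Strict Implicit.
Unset Printing Implicit Defensive.

Import GRing.Theory.

Local Open Scope ring_scope.
Local Open Scope quotient_scope.

Record complex (n : nat) := Complex {
  faces :> {set {set 'I_n}};
  complex_gt0 : (0 < n)%N;
  complex_sub : forall s t : {set 'I_n}, s \subset t -> t \in faces -> s \in faces;
  complex_vertex : forall i : 'I_n, [set i] \in faces
}.

Section Complexes.
Variables (n : nat) (D : complex n).

Definition facets : {set {set 'I_n}} :=
  [set F in faces D | maxset (fun t => t \in faces D) F].

Definition facets_over (s : {set 'I_n}) : {set {set 'I_n}} :=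
  [set F in facets | s \subset F].

Definition face_cl (s : {set 'I_n}) : {set 'I_n} :=
  \bigcap_(F in facets_over s) F.

(* The faces S not containing i but having i in their
   closure, usually written A_i(D). *)
Definition exposing (i : 'I_n) : {set {set 'I_n}} :=
  [set S in faces D | (i \notin S) && (i \in face_cl S)].

Definition exposed (F : {set 'I_n}) : Prop :=
  exists i, exists2 S, S \in exposing i & S \subset F.

Definition fully_exposed : Prop := forall F, F \in facets -> exposed F.
Definition fully_hidden : Prop := forall F, F \in facets -> ~ exposed F.

Definition complex_sym : {set 'S_n} :=
  [set s : 'S_n | [set s @: F | F : {set 'I_n} in faces D] == faces D].

Lemma complex0 : set0 \in faces D.
Proof.
have := complex_vertex D (Ordinal (complex_gt0 D)).
by apply: complex_sub; rewrite sub0set.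
Qed.

End Complexes.

Section StanleyReisner.
Variables (k : fieldType) (n : nat) (D : complex n).

Definition sr_ideal : pred {mpoly k[n]} := fun p =>
  `[< exists q : {set 'I_n} -> {mpoly k[n]},
        p = \sum_(s : {set 'I_n} | s \notin faces D) q s * \prod_(i in s) 'X_i >].

Definition mface (m : 'X_{1..n}) : bool := [set i | m i != 0%N] \in faces D.

Lemma mface_add m1 m2 : mface (m1 + m2)%MM -> mface m2.
Proof.
apply: complex_sub; apply/subsetP=> i; rewrite !inE mnmDE.
by case: (m2 i) => // j _; rewrite addnS.
Qed.

Lemma prod_mpolyXE (s : {set 'I_n}) :
  \prod_(i in s) 'X_i = 'X_[[multinom nat_of_bool (i \in s) | i < n]]
  :> {mpoly k[n]}.
Proof.
rewrite [RHS]mpolyXE_id big_mkcond /=; apply: eq_bigr => i _.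
by rewrite mnmE; case: (i \in s).
Qed.

Lemma supp_indic (s : {set 'I_n}) :
  [set i | [multinom nat_of_bool (j \in s) | j < n] i != 0%N] = s.
Proof. by apply/setP=> i; rewrite inE mnmE; case: (i \in s). Qed.

Lemma mcoeffM_nonface (p q : {mpoly k[n]}) :
  (forall m, mface m -> q@_m = 0) -> forall m, mface m -> (p * q)@_m = 0.
Proof.
move=> hq m hm; rewrite mcoeffM big1 // => -[m1 m2] /= /eqP e.
by rewrite [q@__]hq ?mulr0 //; apply: (@mface_add m1); rewrite -e.
Qed.

Lemma sr_idealDZ p q r : p \in sr_ideal -> q \in sr_ideal -> r * p + q \in sr_ideal.
Proof.
move=> /asboolP[a ->] /asboolP[b ->]; apply/asboolP.
exists (fun s => r * a s + b s); rewrite mulr_sumr -big_split /=.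
by apply: eq_bigr => s _; rewrite mulrDl mulrA.
Qed.

Lemma sr_ideal0 : 0 \in sr_ideal.
Proof. by apply/asboolP; exists (fun=> 0); rewrite big1 // => s _; rewrite mul0r. Qed.

Lemma sr_idealP (p : {mpoly k[n]}) :
  (p \in sr_ideal) <-> (forall m, mface m -> p@_m = 0).
Proof.
split=> [/asboolP[q ->] m hm|hp].
  rewrite linear_sum /= big1 // => s hs.
  apply: mcoeffM_nonface hm => m' hm'; rewrite prod_mpolyXE mcoeffX.
  case: eqP => // e; move: hm'; rewrite -e /mface supp_indic.
  by rewrite (negPf hs).
have sumI (I : Type) (r : seq I) (P : pred I) (F : I -> {mpoly k[n]}) :
    (forall i, P i -> F i \in sr_ideal) -> \sum_(i <- r | P i) F i \in sr_ideal.
  move=> h; apply: (big_ind (fun x => x \in sr_ideal)) h; first exact: sr_ideal0.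
  by move=> x y hx hy; rewrite -[x]mul1r; exact: sr_idealDZ.
rewrite [p]mpolyE; apply: (sumI).
move=> m _; have [hm|hm] := boolP (mface m).
  by rewrite hp // scale0r; exact: sr_ideal0.
set s := [set i | m i != 0%N] in hm.
apply/asboolP.
exists (fun t => if t == s then p@_m *: 'X_[m - [multinom nat_of_bool (i \in s) | i < n]] else 0).
rewrite (bigD1 s) //= eqxx [X in _ = _ + X]big1 ?addr0; last first.
  by move=> t; case/andP=> _ /negPf->; rewrite mul0r.
rewrite prod_mpolyXE -scalerAl -mpolyXD submK //.
by apply/mnm_lepP=> i; rewrite mnmE inE; case: (m i).
Qed.

Lemma sr_ideal_closed : idealr_closed sr_ideal.
Proof.
split; [exact: sr_ideal0| |by move=> r p q; apply: sr_idealDZ].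
have h0 : mface 0%MM.
  rewrite /mface (_ : [set i | _] = set0) ?complex0 //.
  by apply/setP=> i; rewrite !inE mnm0E.
apply/negP=> /sr_idealP /(_ _ h0).
by rewrite mcoeff1 eqxx => /eqP; rewrite oner_eq0.
Qed.

HB.instance Definition _ := isIdealr.Build {mpoly k[n]} sr_ideal sr_ideal_closed.

Definition sr_idealr : idealr {mpoly k[n]} := sr_ideal.

Definition sr_ring := {ideal_quot sr_idealr}.
HB.instance Definition _ := GRing.ComNzRing.on sr_ring.


Definition sr_pi (p : {mpoly k[n]}) : sr_ring := \pi_sr_ring p.

Lemma sr_piB : {morph sr_pi : p q / p - q}.
Proof. by move=> p q; rewrite /sr_pi !piE. Qed.

Lemma sr_pi_monoid : monoid_morphism sr_pi.
Proof. by split=> [|p q]; rewrite /sr_pi !piE. Qed.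

HB.instance Definition _ := GRing.isZmodMorphism.Build _ _ sr_pi sr_piB.
HB.instance Definition _ := GRing.isMonoidMorphism.Build _ _ sr_pi sr_pi_monoid.

Lemma sr_pi_eq (p q : {mpoly k[n]}) : (sr_pi p = sr_pi q) <-> (p - q \in sr_ideal).
Proof. by rewrite Quotient.idealrBE; split=> /eqP. Qed.

Lemma sr_reprK (f : sr_ring) : sr_pi (repr f) = f.
Proof. exact: reprK. Qed.

Definition sr_scale (c : k) (f : sr_ring) : sr_ring := sr_pi c%:MP * f.

Lemma sr_scaleA a b f : sr_scale a (sr_scale b f) = sr_scale (a * b) f.
Proof. by rewrite /sr_scale mulrA -rmorphM mpolyCM. Qed.
Lemma sr_scale1 : left_id 1 sr_scale.
Proof. by move=> f; rewrite /sr_scale mpolyC1 rmorph1 mul1r. Qed.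
Lemma sr_scaleDr : right_distributive sr_scale +%R.
Proof. by move=> a f g; rewrite /sr_scale mulrDr. Qed.
Lemma sr_scaleDl f : {morph sr_scale^~ f : a b / a + b}.
Proof. by move=> a b; rewrite /sr_scale mpolyCD rmorphD mulrDl. Qed.

HB.instance Definition _ := GRing.Zmodule_isLmodule.Build k sr_ring
  sr_scaleA sr_scale1 sr_scaleDr sr_scaleDl.

Lemma sr_scaleAl (a : k) (f g : sr_ring) : a *: (f * g) = a *: f * g.
Proof. exact: mulrA. Qed.

HB.instance Definition _ := GRing.Lmodule_isLalgebra.Build k sr_ring sr_scaleAl.
HB.instance Definition _ := GRing.Lalgebra_isComAlgebra.Build k sr_ring.

Lemma sr_piZ : scalable sr_pi.
Proof. by move=> a p; rewrite -mul_mpolyC rmorphM. Qed.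

HB.instance Definition _ := GRing.isScalable.Build k _ _ _ sr_pi sr_piZ.

Definition sr_var (i : 'I_n) : sr_ring := sr_pi 'X_i.

Definition sr_deg_le (d : nat) (f : sr_ring) : Prop :=
  exists2 p : {mpoly k[n]}, (msize p <= d.+1)%N & sr_pi p = f.

End StanleyReisner.

Section AffineVarieties.
Variable k : fieldType.

Definition peval (J : finType) (p : {mpoly k[#|J|]}) (v : {ffun J -> k}) : k :=
  p.@[fun i => v (enum_val i)].

Definition zariski_closed (J : finType) (Z : {ffun J -> k} -> Prop) : Prop :=
  exists E : {mpoly k[#|J|]} -> Prop,
    forall v, Z v <-> (forall p, E p -> peval p v = 0).

(* The structure of an affine variety on the subset S of T (not necessarily
   irreducible), given by a bijection of S with a Zariski closed subset of the
   affine space k^J, where J is av_index.  Only the values of av_coord on S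
   matter. *)
Record affineVariety (T : Type) (S : T -> Prop) := AffineVariety {
  av_index : finType;
  av_coord : T -> {ffun av_index -> k};
  av_inj : forall x y, S x -> S y -> av_coord x = av_coord y -> x = y;
  av_closed : zariski_closed (fun v => exists2 x, S x & av_coord x = v)
}.

Definition regular_fun (T : Type) (S : T -> Prop) (X : affineVariety S)
    (f : T -> k) : Prop :=
  exists p, forall x, S x -> f x = peval p (av_coord X x).

Definition regular_map (T T' : Type) (S : T -> Prop) (S' : T' -> Prop)
    (X : affineVariety S) (X' : affineVariety S') (f : T -> T') : Prop :=
  (forall x, S x -> S' (f x)) /\
  (forall j, regular_fun X (fun x => av_coord X' (f x) j)).

(* An isomorphism onto a closed subvariety: the last condition says that the
   coordinates of S are regular on the image of f. *)
Definition closed_immersion (T T' : Type) (S : T -> Prop) (S' : T' -> Prop)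
    (X : affineVariety S) (X' : affineVariety S') (f : T -> T') : Prop :=
  [/\ regular_map X X' f,
      zariski_closed (fun v => exists2 x, S x & av_coord X' (f x) = v) &
      forall j, exists p, forall x, S x ->
        av_coord X x j = peval p (av_coord X' (f x))].

(* The pieces are affine: this covers all the ind-groups considered here.  The
   inclusion of each piece in the next one is part of iv_immersion. *)
Record indVariety (T : Type) := IndVariety {
  iv_piece : nat -> T -> Prop;
  iv_variety : forall d, affineVariety (iv_piece d);
  iv_immersion : forall d,
    closed_immersion (iv_variety d) (iv_variety d.+1) (fun x => x);
  iv_cover : forall x, exists d, iv_piece d x
}.

Definition ind_morphism (T T' : Type) (V : indVariety T) (V' : indVariety T')
    (f : T -> T') : Prop :=
  forall d, exists e, regular_map (iv_variety V d) (iv_variety V' e) f.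

Definition pfun (J : finType) (f : {ffun J -> k} -> k) : Prop :=
  exists p, forall v, f v = peval p v.

Lemma peval_coord (J : finType) (j : J) (v : {ffun J -> k}) :
  peval 'X_(enum_rank j) v = v j.
Proof. by rewrite /peval mevalXU enum_rankK. Qed.

Lemma pfun_coord (J : finType) (j : J) : pfun (fun v => v j).
Proof. by exists 'X_(enum_rank j) => v; rewrite peval_coord. Qed.

Lemma pfunC (J : finType) (c : k) : pfun (fun _ : {ffun J -> k} => c).
Proof. by exists c%:MP => v; rewrite /peval mevalC. Qed.

Lemma pfunD (J : finType) (f g : {ffun J -> k} -> k) :
  pfun f -> pfun g -> pfun (fun v => f v + g v).
Proof. by case=> p hp [q hq]; exists (p + q) => v; rewrite hp hq /peval mevalD. Qed.

Lemma pfunM (J : finType) (f g : {ffun J -> k} -> k) :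
  pfun f -> pfun g -> pfun (fun v => f v * g v).
Proof. by case=> p hp [q hq]; exists (p * q) => v; rewrite hp hq /peval rmorphM. Qed.

Lemma pfunB (J : finType) (f g : {ffun J -> k} -> k) :
  pfun f -> pfun g -> pfun (fun v => f v - g v).
Proof. by case=> p hp [q hq]; exists (p - q) => v; rewrite hp hq /peval mevalB. Qed.

Lemma pfun_sum (J I : finType) (F : I -> {ffun J -> k} -> k) :
  (forall i, pfun (F i)) -> pfun (fun v => \sum_i F i v).
Proof.
move=> /choice[p hp]; exists (\sum_i p i) => v.
by rewrite /peval raddf_sum /=; apply: eq_bigr => i _; exact: hp.
Qed.

Lemma pfun_comp (J J' : finType) (f : {ffun J -> k} -> k)
    (g : {ffun J' -> k} -> {ffun J -> k}) :
  pfun f -> (forall j, pfun (fun v => g v j)) -> pfun (fun v => f (g v)).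
Proof.
case=> p hp /choice[q hq].
exists (p \mPo [tuple q (enum_val i) | i < #|J|]) => v.
rewrite hp /peval comp_mpoly_meval; apply: meval_eq => i.
by rewrite tnth_mktuple hq.
Qed.

Lemma zariski_closed_pfun (J : finType) (I : Type) (P : I -> Prop)
    (f : I -> {ffun J -> k} -> k) (Z : {ffun J -> k} -> Prop) :
  (forall i, P i -> pfun (f i)) ->
  (forall v, Z v <-> forall i, P i -> f i v = 0) -> zariski_closed Z.
Proof.
move=> hf hZ.
exists (fun p => exists2 i, P i & forall v, peval p v = f i v) => v.
split=> [/hZ h p [i Pi ->]|h]; first exact: h.
apply/hZ => i Pi; have [p hp] := hf i Pi.
by rewrite hp; apply: h; exists i.
Qed.

Lemma zariski_closed_preim (J J' : finType) (Z : {ffun J -> k} -> Prop)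
    (g : {ffun J' -> k} -> {ffun J -> k}) :
  zariski_closed Z -> (forall j, pfun (fun v => g v j)) ->
  zariski_closed (fun v => Z (g v)).
Proof.
case=> E hE hg.
apply: (@zariski_closed_pfun J' _ E (fun p v => peval p (g v))) => // p _.
by apply: pfun_comp => //; exists p.
Qed.

Lemma zariski_closedI (J : finType) (Z Z' : {ffun J -> k} -> Prop) :
  zariski_closed Z -> zariski_closed Z' -> zariski_closed (fun v => Z v /\ Z' v).
Proof.
case=> E hE [E' hE']; exists (fun p => E p \/ E' p) => v; split.
  by case=> /hE h /hE' h' p [/h|/h'].
by move=> h; split; [apply/hE|apply/hE'] => p hp; apply: h; [left|right].
Qed.

Lemma zariski_closed_ext (J : finType) (Z Z' : {ffun J -> k} -> Prop) :
  (forall v, Z v <-> Z' v) -> zariski_closed Z -> zariski_closed Z'.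
Proof.
by move=> h [E hE]; exists E => v; split=> [/h /hE|/hE /h].
Qed.

Section Product.
Variables (T T' : Type).

Definition pair_coord (J J' : finType) (v : {ffun J -> k}) (v' : {ffun J' -> k}) :
    {ffun J + J' -> k} :=
  [ffun j => match j with inl j => v j | inr j => v' j end].

Definition fst_coord (J J' : finType) (v : {ffun J + J' -> k}) : {ffun J -> k} :=
  [ffun j => v (inl j)].
Definition snd_coord (J J' : finType) (v : {ffun J + J' -> k}) : {ffun J' -> k} :=
  [ffun j => v (inr j)].

Lemma pair_coordE (J J' : finType) (v : {ffun J + J' -> k}) :
  pair_coord (fst_coord v) (snd_coord v) = v.
Proof. by apply/ffunP=> -[j|j]; rewrite !ffunE. Qed.
Lemma fst_pair (J J' : finType) (v : {ffun J -> k}) (v' : {ffun J' -> k}) :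
  fst_coord (pair_coord v v') = v.
Proof. by apply/ffunP=> j; rewrite !ffunE. Qed.
Lemma snd_pair (J J' : finType) (v : {ffun J -> k}) (v' : {ffun J' -> k}) :
  snd_coord (pair_coord v v') = v'.
Proof. by apply/ffunP=> j; rewrite !ffunE. Qed.

Lemma pfun_fst (J J' : finType) j : pfun (fun v : {ffun J + J' -> k} => fst_coord v j).
Proof.
by have [p hp] := pfun_coord (inl j : J + J'); exists p => v; rewrite -hp ffunE.
Qed.
Lemma pfun_snd (J J' : finType) j : pfun (fun v : {ffun J + J' -> k} => snd_coord v j).
Proof.
by have [p hp] := pfun_coord (inr j : J + J'); exists p => v; rewrite -hp ffunE.
Qed.

Lemma zariski_closed_pair (J J' : finType) (S : T -> Prop) (S' : T' -> Prop)
    (f : T -> {ffun J -> k}) (f' : T' -> {ffun J' -> k}) :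
  zariski_closed (fun v => exists2 x, S x & f x = v) ->
  zariski_closed (fun v => exists2 x, S' x & f' x = v) ->
  zariski_closed (fun v => exists2 x, S x.1 /\ S' x.2 &
                                      pair_coord (f x.1) (f' x.2) = v).
Proof.
move=> h h'.
have c := zariski_closed_preim h (@pfun_fst J J').
have c' := zariski_closed_preim h' (@pfun_snd J J').
apply: zariski_closed_ext (zariski_closedI c c') => v; split.
  case=> -[x Sx ex] [y Sy ey]; exists (x, y) => //=.
  by rewrite ex ey pair_coordE.
case=> -[x y] /= [Sx Sy] <-; rewrite fst_pair snd_pair.
by split; [exists x|exists y].
Qed.

Variables (S : T -> Prop) (S' : T' -> Prop).
Variables (X : affineVariety S) (X' : affineVariety S').

Definition prod_coord (x : T * T') := pair_coord (av_coord X x.1) (av_coord X' x.2).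

Lemma prod_inj x y : S x.1 /\ S' x.2 -> S y.1 /\ S' y.2 ->
  prod_coord x = prod_coord y -> x = y.
Proof.
case: x y => [x x'] [y y'] /= [Sx Sx'] [Sy Sy'] e.
rewrite (av_inj Sx Sy (_ : av_coord X x = _)); last first.
  by have := congr1 (@fst_coord _ _) e; rewrite !fst_pair.
rewrite (av_inj Sx' Sy' (_ : av_coord X' x' = _)) //.
by have := congr1 (@snd_coord _ _) e; rewrite !snd_pair.
Qed.

Definition prod_variety : affineVariety (fun x : T * T' => S x.1 /\ S' x.2) :=
  AffineVariety prod_inj (zariski_closed_pair (av_closed X) (av_closed X')).

Lemma regular_fun_fst f : regular_fun X f -> regular_fun prod_variety (fun x => f x.1).
Proof.
case=> p hp.
have [q hq] : pfun (fun v : {ffun av_index prod_variety -> k} => peval p (fst_coord v)).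
  by apply: pfun_comp; [exists p|exact: pfun_fst].
by exists q => x [Sx _]; rewrite -hq hp // fst_pair.
Qed.

Lemma regular_fun_snd f : regular_fun X' f -> regular_fun prod_variety (fun x => f x.2).
Proof.
case=> p hp.
have [q hq] : pfun (fun v : {ffun av_index prod_variety -> k} => peval p (snd_coord v)).
  by apply: pfun_comp; [exists p|exact: pfun_snd].
by exists q => x [_ Sx]; rewrite -hq hp // snd_pair.
Qed.

End Product.

Section IndProduct.
Variables (T T' : Type) (V : indVariety T) (V' : indVariety T').

Lemma iv_mono (U : Type) (W : indVariety U) d e x :
  (d <= e)%N -> iv_piece W d x -> iv_piece W e x.
Proof.
move=> /subnK <-; elim: (e - d)%N => // i IH /IH.
by have [[h _] _ _] := iv_immersion W (i + d); apply: h.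
Qed.

Lemma prod_immersion d :
  closed_immersion (prod_variety (iv_variety V d) (iv_variety V' d))
    (prod_variety (iv_variety V d.+1) (iv_variety V' d.+1)) (fun x => x).
Proof.
have [[h1 h2] h3 h4] := iv_immersion V d.
have [[h1' h2'] h3' h4'] := iv_immersion V' d.
split; first split.
- by case=> x y [/h1 hx /h1' hy].
- case=> j.
    have [p hp] := regular_fun_fst (iv_variety V' d) (h2 j).
    by exists p => x Sx; rewrite -hp // ffunE.
  have [p hp] := regular_fun_snd (iv_variety V d) (h2' j).
  by exists p => x Sx; rewrite -hp // ffunE.
- exact: (zariski_closed_pair h3 h3').
case=> j.
  have [p hp] := h4 j.
  have [q hq] : pfun (fun v : {ffun av_index (iv_variety V d.+1) +
      av_index (iv_variety V' d.+1) -> k} => peval p (fst_coord v)).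
    by apply: pfun_comp; [exists p|exact: pfun_fst].
  by exists q => x [Sx _]; rewrite -hq fst_pair ffunE hp.
have [p hp] := h4' j.
have [q hq] : pfun (fun v : {ffun av_index (iv_variety V d.+1) +
      av_index (iv_variety V' d.+1) -> k} => peval p (snd_coord v)).
  by apply: pfun_comp; [exists p|exact: pfun_snd].
by exists q => x [_ Sx]; rewrite -hq snd_pair ffunE hp.
Qed.

Lemma prod_cover (x : T * T') :
  exists d, iv_piece V d x.1 /\ iv_piece V' d x.2.
Proof.
have [d hd] := iv_cover V x.1; have [e he] := iv_cover V' x.2.
exists (maxn d e); split.
  by apply: iv_mono hd; rewrite leq_maxl.
by apply: iv_mono he; rewrite leq_maxr.
Qed.

Definition ind_prod : indVariety (T * T') := IndVariety prod_immersion prod_cover.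

End IndProduct.

Section Constant.
Variables (T : Type) (X : affineVariety (fun _ : T => True)).

Lemma const_immersion : closed_immersion X X (fun x => x).
Proof.
split=> [||j]; last by have [p hp] := pfun_coord j; exists p => x _; rewrite -hp.
  by split=> // j; have [p hp] := pfun_coord j; exists p => x _; rewrite -hp.
exact: av_closed.
Qed.

Lemma const_cover (x : T) : exists d : nat, True.
Proof. by exists 0%N. Qed.

Definition const_ind : indVariety T :=
  @IndVariety T (fun _ _ => True) (fun=> X) (fun=> const_immersion) const_cover.

End Constant.

Record indGroup := IndGroup {
  ig_group :> groupType;
  ig_variety : indVariety ig_group;
  ig_mul : ind_morphism (ind_prod ig_variety ig_variety) ig_variety
             (fun x => (x.1 * x.2)%g);
  ig_inv : ind_morphism ig_variety ig_variety (fun x => (x^-1)%g)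
}.

Definition ind_isomorphic (G H : indGroup) : Prop :=
  exists (f : G -> H) (g : H -> G),
    [/\ cancel f g, cancel g f, {morph f : x y / (x * y)%g},
        ind_morphism (ig_variety G) (ig_variety H) f &
        ind_morphism (ig_variety H) (ig_variety G) g].

End AffineVarieties.

Section Coefficients.
Variables (k : fieldType) (n : nat) (D : complex n).
Local Notation A := (sr_ring k D).

(* The coefficients of an element of k[D] in the basis of the monomials whose
   support is a face. *)
Definition sr_coef (m : 'X_{1..n}) (f : A) : k :=
  if mface D m then (repr f)@_m else 0.

Lemma sr_coef_pi m (p : {mpoly k[n]}) :
  sr_coef m (sr_pi D p) = if mface D m then p@_m else 0.
Proof.
rewrite /sr_coef; case: ifP => // hm.
have /sr_pi_eq/sr_idealP/(_ m hm) : sr_pi D (repr (sr_pi D p)) = sr_pi D p.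
  exact: sr_reprK.
by rewrite mcoeffB => /eqP; rewrite subr_eq0 => /eqP.
Qed.

Lemma sr_coef_inj (f g : A) : (forall m, sr_coef m f = sr_coef m g) -> f = g.
Proof.
move=> h; rewrite -[f]sr_reprK -[g]sr_reprK; apply/sr_pi_eq/sr_idealP => m hm.
by have := h m; rewrite /sr_coef hm mcoeffB => ->; rewrite subrr.
Qed.

Lemma sr_coef0 m : sr_coef m (0 : A) = 0.
Proof. by rewrite -(raddf0 (sr_pi D)) sr_coef_pi mcoeff0 if_same. Qed.

Lemma sr_coef_nonface m (f : A) : ~~ mface D m -> sr_coef m f = 0.
Proof. by rewrite /sr_coef => /negPf->. Qed.

Lemma sr_coefB m (f g : A) : sr_coef m (f - g) = sr_coef m f - sr_coef m g.
Proof.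
rewrite -[f]sr_reprK -[g]sr_reprK -rmorphB !sr_coef_pi mcoeffB.
by case: ifP; rewrite ?subr0.
Qed.

Definition sr_gen (d : nat) (c : 'X_{1..n < d.+1} -> k) : A :=
  \sum_m c m *: sr_pi D 'X_[m].

Lemma sr_genE d c :
  @sr_gen d c = sr_pi D (\sum_(m : 'X_{1..n < d.+1}) c m *: 'X_[m]).
Proof. by rewrite raddf_sum; apply: eq_bigr => m _; rewrite /= linearZ. Qed.

Lemma mcoeff_bsum d (c : 'X_{1..n < d.+1} -> k) (m : 'X_{1..n}) :
  (\sum_(m : 'X_{1..n < d.+1}) c m *: 'X_[m] : {mpoly k[n]})@_m =
  if insub m is Some m' then c m' else 0.
Proof.
rewrite linear_sum /=; case: insubP => [m' _ <-|hm].
  rewrite (bigD1 m') //= mcoeffZ mcoeffX eqxx mulr1 big1 ?addr0 //.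
  move=> m'' ne; rewrite mcoeffZ mcoeffX; case: eqP => [e|]; last by rewrite mulr0.
  by case/eqP: ne; apply: val_inj.
rewrite big1 // => m' _; rewrite mcoeffZ mcoeffX; case: eqP => [e|].
  by rewrite -e bmdeg in hm.
by rewrite mulr0.
Qed.

Lemma sr_coef_gen d c (m : 'X_{1..n < d.+1}) :
  sr_coef m (sr_gen c) = if mface D m then c m else 0.
Proof. by rewrite sr_genE sr_coef_pi mcoeff_bsum valK. Qed.

Lemma sr_deg_gen d c : sr_deg_le d (@sr_gen d c).
Proof.
exists (\sum_(m : 'X_{1..n < d.+1}) c m *: 'X_[m]); last by rewrite sr_genE.
rewrite msizeE; apply/bigmax_leqP_seq => m hm _.
rewrite mcoeff_msupp mcoeff_bsum in hm.
by case: insubP hm => [//|]; rewrite eqxx.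
Qed.

Lemma sr_degE d (f : A) : sr_deg_le d f -> f = sr_gen (fun m : 'X_{1..n < d.+1} => sr_coef m f).
Proof.
case=> p hp <-; apply: sr_coef_inj => m.
rewrite sr_genE !sr_coef_pi; case: ifP => // hm.
rewrite mcoeff_bsum; case: insubP => [m' _ e|hm'].
  by rewrite e sr_coef_pi hm.
apply/memN_msupp_eq0/msize_mdeg_ge/(leq_trans hp).
by rewrite leqNgt.
Qed.

Lemma sr_deg_mono d e (f : A) : (d <= e)%N -> sr_deg_le d f -> sr_deg_le e f.
Proof. by move=> h [p hp <-]; exists p => //; apply: leq_trans hp _. Qed.

Lemma sr_deg_ex (f : A) : exists d, sr_deg_le d f.
Proof. by exists (msize (repr f)), (repr f); rewrite ?sr_reprK. Qed.

Lemma sr_deg_bound (I : finType) (f : I -> A) : exists d, forall i, sr_deg_le d (f i).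
Proof.
have /choice[d hd] := fun i => sr_deg_ex (f i).
by exists (\max_i d i) => i; apply: sr_deg_mono (hd i); apply: leq_bigmax.
Qed.

Lemma sr_hom_ext (f g : {lrmorphism A -> A}) :
  (forall i, f (sr_var k D i) = g (sr_var k D i)) -> f =1 g.
Proof.
move=> h x; rewrite -[x]sr_reprK [repr x]mpolyE !raddf_sum /=.
apply: eq_bigr => m _; rewrite !linearZ; congr (_ *: _) => /=.
rewrite mpolyXE_id !rmorph_prod /=; apply: eq_bigr => i _.
by rewrite !rmorphXn /= h.
Qed.

Lemma lrmorphism_eq (f g : {lrmorphism A -> A}) : f =1 g -> f = g.
Proof.
case: f g => [f [[f1] [f2] [f3]]] [g [[g1] [g2] [g3]]] /= /funext e.
case: _ / e g1 g2 g3 => g1 g2 g3.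
by rewrite (Prop_irrelevance f1 g1) (Prop_irrelevance f2 g2) (Prop_irrelevance f3 g3).
Qed.

Section Lift.
Variables (y : 'I_n -> A).
Hypothesis y0 : forall s : {set 'I_n}, s \notin faces D -> \prod_(i in s) y i = 0.

Definition sr_subst (p : {mpoly k[n]}) : A := mmap (in_alg A) y p.

Lemma sr_subst_ideal p : p \in sr_ideal D -> sr_subst p = 0.
Proof.
case/asboolP=> q ->; rewrite /sr_subst raddf_sum big1 //= => s hs.
rewrite rmorphM rmorph_prod /= (eq_bigr y) ?y0 ?mulr0 // => i _.
by rewrite mmapX mmap1U.
Qed.

Definition sr_lift (f : A) : A := sr_subst (repr f).

Lemma sr_lift_pi p : sr_lift (sr_pi D p) = sr_subst p.
Proof.
apply/eqP; rewrite -subr_eq0 /sr_lift /sr_subst -raddfB.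
by apply/eqP/sr_subst_ideal/sr_pi_eq; exact: sr_reprK.
Qed.

Lemma sr_liftB : {morph sr_lift : f g / f - g}.
Proof.
move=> f g; rewrite -[f]sr_reprK -[g]sr_reprK -rmorphB !sr_lift_pi.
exact: raddfB.
Qed.
Lemma sr_lift_monoid : monoid_morphism sr_lift.
Proof.
split=> [|f g]; first by rewrite -(rmorph1 (sr_pi D)) sr_lift_pi /sr_subst !rmorph1.
rewrite -[f]sr_reprK -[g]sr_reprK -rmorphM !sr_lift_pi; exact: rmorphM.
Qed.
Lemma sr_liftZ : scalable sr_lift.
Proof.
move=> c f; rewrite -[f]sr_reprK -linearZ !sr_lift_pi /sr_subst mmapZ /=.
by rewrite mulr_algl.
Qed.

HB.instance Definition _ := GRing.isZmodMorphism.Build _ _ sr_lift sr_liftB.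
HB.instance Definition _ := GRing.isMonoidMorphism.Build _ _ sr_lift sr_lift_monoid.
HB.instance Definition _ := GRing.isScalable.Build k _ _ _ sr_lift sr_liftZ.

Definition sr_lift_hom : {lrmorphism A -> A} := sr_lift.

Lemma sr_lift_var i : sr_lift_hom (sr_var k D i) = y i.
Proof. by rewrite /= sr_lift_pi /sr_subst mmapX mmap1U. Qed.

End Lift.

Definition pfam (J : finType) (F : {ffun J -> k} -> A) : Prop :=
  exists P : {mpoly {mpoly k[#|J|]}[n]},
    forall v, F v = sr_pi D (map_mpoly (meval (fun i => v (enum_val i))) P).

Lemma pfamC (J : finType) (f : A) : pfam (fun _ : {ffun J -> k} => f).
Proof.
exists (map_mpoly (@mpolyC _ k) (repr f)) => v.
rewrite (_ : map_mpoly _ _ = repr f) ?sr_reprK //.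
by apply/mpolyP=> m; rewrite !mcoeff_map_mpoly /= mevalC.
Qed.

Lemma pfamM (J : finType) (F G : {ffun J -> k} -> A) :
  pfam F -> pfam G -> pfam (fun v => F v * G v).
Proof. by case=> P hP [Q hQ]; exists (P * Q) => v; rewrite hP hQ !rmorphM. Qed.

Lemma pfamB (J : finType) (F G : {ffun J -> k} -> A) :
  pfam F -> pfam G -> pfam (fun v => F v - G v).
Proof. by case=> P hP [Q hQ]; exists (P - Q) => v; rewrite hP hQ !rmorphB. Qed.

Lemma pfamZ (J : finType) (c : {ffun J -> k} -> k) (F : {ffun J -> k} -> A) :
  pfun c -> pfam F -> pfam (fun v => c v *: F v).
Proof.
case=> p hp [P hP]; exists (p *: P) => v.
by rewrite hp hP map_mpolyZ linearZ.
Qed.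

Lemma pfam_sum (J I : finType) (F : I -> {ffun J -> k} -> A) :
  (forall i, pfam (F i)) -> pfam (fun v => \sum_i F i v).
Proof.
move=> /choice[P hP]; exists (\sum_i P i) => v.
rewrite (raddf_sum (map_mpoly (meval (fun i => v (enum_val i))))) raddf_sum.
by apply: eq_bigr => i _; exact: hP.
Qed.

Lemma pfam_prod (J I : finType) (C : pred I) (F : I -> {ffun J -> k} -> A) :
  (forall i, pfam (F i)) -> pfam (fun v => \prod_(i | C i) F i v).
Proof.
move=> /choice[P hP]; exists (\prod_(i | C i) P i) => v.
by rewrite !rmorph_prod; apply: eq_bigr => i _; exact: hP.
Qed.

Lemma pfamX (J : finType) (F : {ffun J -> k} -> A) e :
  pfam F -> pfam (fun v => F v ^+ e).
Proof. by case=> P hP; exists (P ^+ e) => v; rewrite hP !rmorphXn. Qed.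

Lemma pfam_coef (J : finType) (F : {ffun J -> k} -> A) m :
  pfam F -> pfun (fun v => sr_coef m (F v)).
Proof.
case=> P hP; exists (if mface D m then P@_m else 0) => v.
rewrite hP sr_coef_pi; case: ifP => _; first by rewrite mcoeff_map_mpoly.
by rewrite /peval meval0.
Qed.

Lemma pfam_gen (J : finType) d (c : 'X_{1..n < d.+1} -> {ffun J -> k} -> k) :
  (forall m, pfun (c m)) -> pfam (fun v => sr_gen (fun m => c m v)).
Proof. by move=> h; apply: pfam_sum => m; apply: pfamZ => //; apply: pfamC. Qed.

End Coefficients.

Section Automorphisms.
Variables (k : fieldType) (n : nat) (D : complex n).
Local Notation A := (sr_ring k D).
Local Notation x_ := (sr_var k D).

Record sr_aut := SrAut {
  aut_fun : {lrmorphism A -> A};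
  aut_inv : {lrmorphism A -> A};
  aut_funK : cancel aut_fun aut_inv;
  aut_invK : cancel aut_inv aut_fun
}.

HB.instance Definition _ := gen_eqMixin sr_aut.
HB.instance Definition _ := gen_choiceMixin sr_aut.

Lemma sr_aut_eq (x y : sr_aut) : aut_fun x =1 aut_fun y -> x = y.
Proof.
move=> e; have ei : aut_inv x =1 aut_inv y.
  by move=> f; rewrite -{1}[f](aut_invK y) -e aut_funK.
case: x y e ei => [f g fK gK] [f' g' fK' gK'] /= e ei.
move: (lrmorphism_eq e) (lrmorphism_eq ei) => ef eg.
case: _ / ef fK' gK' => fK'; case: _ / eg fK' => fK' gK'.
by rewrite (Prop_irrelevance fK fK') (Prop_irrelevance gK gK').
Qed.

Definition aut_one : sr_aut :=
  @SrAut (idfun : {lrmorphism A -> A}) (idfun : {lrmorphism A -> A})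
    (fun=> erefl) (fun=> erefl).

Definition aut_mul (x y : sr_aut) : sr_aut :=
  @SrAut (aut_fun x \o aut_fun y : {lrmorphism A -> A})
    (aut_inv y \o aut_inv x : {lrmorphism A -> A})
    (can_comp (aut_funK x) (aut_funK y)) (can_comp (aut_invK y) (aut_invK x)).

Definition aut_invg (x : sr_aut) : sr_aut := SrAut (aut_invK x) (aut_funK x).

Lemma aut_mulA : associative aut_mul.
Proof. by move=> x y z; apply: sr_aut_eq. Qed.
Lemma aut_mul1 : left_id aut_one aut_mul.
Proof. by move=> x; apply: sr_aut_eq. Qed.
Lemma aut_1mul : right_id aut_one aut_mul.
Proof. by move=> x; apply: sr_aut_eq. Qed.
Lemma aut_mulV : left_inverse aut_one aut_invg aut_mul.
Proof. by move=> x; apply: sr_aut_eq => f /=; rewrite aut_funK. Qed.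
Lemma aut_Vmul : right_inverse aut_one aut_invg aut_mul.
Proof. by move=> x; apply: sr_aut_eq => f /=; rewrite aut_invK. Qed.

HB.instance Definition _ := isGroup.Build sr_aut
  aut_mulA aut_mul1 aut_1mul aut_mulV aut_Vmul.

Definition aut_piece (d : nat) (x : sr_aut) : Prop :=
  forall l, sr_deg_le d (aut_fun x (x_ l)) /\ sr_deg_le d (aut_inv x (x_ l)).

Definition aut_dir (x : sr_aut) (b : bool) : {lrmorphism A -> A} :=
  if b then aut_fun x else aut_inv x.

Lemma aut_pieceP d x :
  aut_piece d x <-> (forall b l, sr_deg_le d (aut_dir x b (x_ l))).
Proof.
split=> [h [] l|h l]; [exact: (h l).1|exact: (h l).2|].
by split; [exact: (h true)|exact: (h false)].
Qed.

Definition aut_index (d : nat) : finType :=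
  (bool * 'I_n * 'X_{1..n < d.+1})%type.

(* The automorphism is identified with the pair of itself and its inverse; the
   two sets of coordinates are distinguished by the boolean index. *)
Definition aut_coord (d : nat) (x : sr_aut) : {ffun aut_index d -> k} :=
  [ffun j : aut_index d => sr_coef j.2 (aut_dir x j.1.1 (x_ j.1.2))].

(* The image of the l-th variable recovered from the coordinates. *)
Definition aut_image (d : nat) (v : {ffun aut_index d -> k}) b l : A :=
  sr_gen D (fun m : 'X_{1..n < d.+1} => v (b, l, m)).

Lemma aut_imageE d x b l : aut_piece d x ->
  aut_dir x b (x_ l) = aut_image (aut_coord d x) b l.
Proof.
move=> /aut_pieceP h; rewrite [LHS](sr_degE (h b l)); congr (sr_gen D _).
by apply/funext=> m; rewrite ffunE.
Qed.

Lemma pfam_image (J : finType) d (g : {ffun J -> k} -> {ffun aut_index d -> k}) b l :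
  (forall j, pfun (fun v => g v j)) -> pfam (fun v => aut_image (g v) b l).
Proof.
by move=> h; apply: (@pfam_gen _ _ _ J d (fun m v => g v (b, l, m))) => m.
Qed.

Lemma aut_coord_inj d x y : aut_piece d x -> aut_piece d y ->
  aut_coord d x = aut_coord d y -> x = y.
Proof.
move=> hx hy e; apply: sr_aut_eq; apply: sr_hom_ext => l.
by rewrite (aut_imageE true l hx) (aut_imageE true l hy) e.
Qed.

Definition aut_subst (d e : nat) (v : {ffun aut_index d -> k}) b
    (c : 'X_{1..n < e.+1} -> k) : A :=
  \sum_m c m *: \prod_i aut_image v b i ^+ m i.

Lemma hom_gen (f : {lrmorphism A -> A}) e (c : 'X_{1..n < e.+1} -> k) :
  f (sr_gen D c) = \sum_m c m *: \prod_i f (x_ i) ^+ m i.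
Proof.
rewrite raddf_sum; apply: eq_bigr => m _; rewrite /= linearZ; congr (_ *: _) => /=.
by rewrite mpolyXE_id !rmorph_prod; apply: eq_bigr => i _; rewrite /= !rmorphXn.
Qed.

Lemma pfam_subst (J : finType) d e (g : {ffun J -> k} -> {ffun aut_index d -> k}) b
    (c : 'X_{1..n < e.+1} -> {ffun J -> k} -> k) :
  (forall j, pfun (fun v => g v j)) -> (forall m, pfun (c m)) ->
  pfam (fun v => aut_subst (g v) b (fun m => c m v)).
Proof.
move=> hg hc; apply: pfam_sum => m; apply: pfamZ => //.
by apply: pfam_prod => i; apply: pfamX; apply: pfam_image.
Qed.

Lemma aut_dirK x b : cancel (aut_dir x b) (aut_dir x (~~ b)).
Proof. by case: b => f; [exact: aut_funK|exact: aut_invK]. Qed.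

Definition aut_eqs d (v : {ffun aut_index d -> k}) : Prop :=
  [/\ forall b l (m : 'X_{1..n < d.+1}), ~~ mface D m -> v (b, l, m) = 0,
      forall b (s : {set 'I_n}), s \notin faces D ->
        \prod_(i in s) aut_image v b i = 0 &
      forall b l, aut_subst v (~~ b) (fun m : 'X_{1..n < d.+1} => v (b, l, m)) = x_ l].

Lemma aut_eqsP d (v : {ffun aut_index d -> k}) :
  (exists2 x, aut_piece d x & aut_coord d x = v) <-> aut_eqs v.
Proof.
split=> [[x hx <-]|[h1 h2 h3]].
  have hi b l := aut_imageE b l hx.
  split=> [b l m hm|b s hs|b l].
  - by rewrite ffunE sr_coef_nonface.
  - under eq_bigr => i _ do rewrite -hi.
    rewrite -rmorph_prod /= (_ : \prod_(i in s) x_ i = 0) ?raddf0 //.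
    rewrite -rmorph_prod -(raddf0 (sr_pi D)); apply/sr_pi_eq; rewrite subr0.
    apply/asboolP; exists (fun t => (t == s)%:R).
    rewrite (bigD1 s) //= eqxx mul1r [X in _ = _ + X]big1 ?addr0 // => t.
    by case/andP=> _ /negPf->; rewrite mul0r.
  rewrite -[RHS](aut_dirK x b) hi /aut_image hom_gen.
  by apply: eq_bigr => m _; congr (_ *: _); apply: eq_bigr => i _; rewrite hi.
have [f fv] : exists f : bool -> {lrmorphism A -> A},
    forall b l, f b (x_ l) = aut_image v b l.
  by exists (fun b => sr_lift_hom (h2 b)) => b l; exact: sr_lift_var.
have fK b : cancel (f b) (f (~~ b)).
  move=> z; apply: (@sr_hom_ext k n D (f (~~ b) \o f b : {lrmorphism A -> A}) idfun).
  move=> i; rewrite -[RHS](h3 b) /= fv /aut_image hom_gen.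
  by apply: eq_bigr => m _; congr (_ *: _); apply: eq_bigr => j _; rewrite fv.
exists (SrAut (fK true) (fK false)); last first.
  apply/ffunP=> -[[b l] m]; rewrite ffunE /= (_ : aut_dir _ b = f b); last by case: b.
  by rewrite fv sr_coef_gen; case: ifPn => // /h1 ->.
by move=> l /=; rewrite !fv; split; apply: sr_deg_gen.
Qed.

Lemma aut_closed d :
  zariski_closed (fun v => exists2 x, aut_piece d x & aut_coord d x = v).
Proof.
apply: (@zariski_closed_ext _ _ (@aut_eqs d)) => [v|]; first by rewrite aut_eqsP.
pose P1 (i : bool * 'I_n * 'X_{1..n < d.+1}) : Prop := ~~ mface D i.2.
pose P2 (i : bool * {set 'I_n} * 'X_{1..n}) : Prop := i.1.2 \notin faces D.
have c1 : zariski_closed (fun v : {ffun aut_index d -> k} => forall i, P1 i -> v i = 0).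
  by apply: (@zariski_closed_pfun _ _ _ P1 (fun i v => v i)) => // i _; apply: pfun_coord.
have c2 : zariski_closed (fun v : {ffun aut_index d -> k} => forall i, P2 i ->
    sr_coef i.2 (\prod_(j in i.1.2) aut_image v i.1.1 j) = 0).
  apply: (@zariski_closed_pfun _ _ _ P2 (fun i v =>
    sr_coef i.2 (\prod_(j in i.1.2) aut_image v i.1.1 j))) => // i _.
  apply: pfam_coef; apply: pfam_prod => j; apply: pfam_image => j'.
  exact: pfun_coord.
have c3 : zariski_closed (fun v : {ffun aut_index d -> k} =>
    forall i : bool * 'I_n * 'X_{1..n}, True ->
    sr_coef i.2 (aut_subst v (~~ i.1.1)
      (fun m : 'X_{1..n < d.+1} => v (i.1.1, i.1.2, m)) - x_ i.1.2) = 0).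
  apply: (@zariski_closed_pfun _ _ _ (fun=> True)
    (fun i v => sr_coef i.2 (aut_subst v (~~ i.1.1)
      (fun m : 'X_{1..n < d.+1} => v (i.1.1, i.1.2, m)) - x_ i.1.2))) => // i _.
  apply: pfam_coef; apply: pfamB; last exact: pfamC.
  apply: (@pfam_subst _ d d id _ (fun m v => v (i.1.1, i.1.2, m))) => *;
    exact: pfun_coord.
apply: zariski_closed_ext (zariski_closedI c1 (zariski_closedI c2 c3)) => v.
split=> [[h1 [h2 h3]]|[h1 h2 h3]].
  split=> [b l m hm|b s hs|b l]; first exact: (h1 (b, l, m)).
    by apply: sr_coef_inj => m; rewrite sr_coef0; apply: (h2 (b, s, m)).
  apply/eqP; rewrite -subr_eq0; apply/eqP; apply: sr_coef_inj => m.
  by rewrite sr_coef0; apply: (h3 (b, l, m)).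
split; first by move=> [[b l] m]; apply: h1.
split; first by move=> [[b s] m] /= hs; rewrite h2 // sr_coef0.
by move=> [[b l] m] _ /=; rewrite h3 subrr sr_coef0.
Qed.

Definition aut_variety (d : nat) : affineVariety k (aut_piece d) :=
  AffineVariety (@aut_coord_inj d) (aut_closed d).

Lemma aut_piece_mono d e x : (d <= e)%N -> aut_piece d x -> aut_piece e x.
Proof.
by move=> h hx l; split; apply: sr_deg_mono h _; [exact: (hx l).1|exact: (hx l).2].
Qed.

Lemma regular_coef d m b l :
  regular_fun (aut_variety d) (fun x => sr_coef m (aut_dir x b (x_ l))).
Proof.
have [p hp] : pfun (fun v : {ffun aut_index d -> k} => sr_coef m (aut_image v b l)).
  by apply: pfam_coef; apply: pfam_image => j; apply: pfun_coord.
by exists p => x hx; rewrite -hp -aut_imageE.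
Qed.

Lemma aut_immersion d :
  closed_immersion (aut_variety d) (aut_variety d.+1) (fun x => x).
Proof.
have mono x : aut_piece d x -> aut_piece d.+1 x by apply: aut_piece_mono.
split.
- split=> // -[[b l] m]; have [p hp] := regular_coef d m b l.
  by exists p => x hx; rewrite -hp // ffunE.
- have c := aut_closed d.+1.
  pose P (i : aut_index d.+1) : Prop := mdeg i.2 = d.+1.
  have c' : zariski_closed (fun v : {ffun aut_index d.+1 -> k} =>
      forall i, P i -> v i = 0).
    by apply: (@zariski_closed_pfun _ _ _ P (fun i v => v i)) => // i _;
      apply: pfun_coord.
  apply: zariski_closed_ext (zariski_closedI c c') => v; split.
    case=> -[x hx <-] h0; exists x => //; apply/aut_pieceP => b l.
    exists (\sum_(m : 'X_{1..n < d.+2}) aut_coord d.+1 x (b, l, m) *: 'X_[m]); last first.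
      by rewrite (aut_imageE b l hx) /aut_image sr_genE.
    rewrite msizeE; apply/bigmax_leqP_seq => m hm _.
    rewrite mcoeff_msupp mcoeff_bsum in hm.
    case: insubP hm => [m' hm' e|]; last by rewrite eqxx.
    rewrite ltnS in hm'.
    have := hm'; rewrite leq_eqVlt => /orP[/eqP hd|//].
    by rewrite h0 ?eqxx // /P /= e.
  case=> x hx <-; split; first by exists x; first exact: mono.
  move=> [[b l] m] hm; rewrite ffunE /=.
  have /aut_pieceP/(_ b l) hd := hx.
  rewrite (sr_degE hd) sr_genE sr_coef_pi mcoeff_bsum.
  case: insubP => [m' _ e|_]; last by rewrite if_same.
  by have := bmdeg m'; rewrite e hm ltnn.
move=> [[b l] m].
have lt : (mdeg m < d.+2)%N by apply: ltn_trans (bmdeg m) _.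
have [p hp] := pfun_coord k ((b, l, BMultinom lt) : aut_index d.+1).
by exists p => x hx; rewrite -hp !ffunE.
Qed.

Lemma aut_cover x : exists d, aut_piece d x.
Proof.
have [d hd] := sr_deg_bound (fun l => aut_fun x (x_ l)).
have [e he] := sr_deg_bound (fun l => aut_inv x (x_ l)).
exists (maxn d e) => l; split; first by apply: sr_deg_mono (hd l); rewrite leq_maxl.
by apply: sr_deg_mono (he l); rewrite leq_maxr.
Qed.

Definition aut_ind : indVariety k sr_aut := IndVariety aut_immersion aut_cover.

Lemma aut_ind_inv : ind_morphism aut_ind aut_ind (fun x => (x^-1)%g).
Proof.
move=> d; exists d; split=> [x hx l|[[b l] m]].
  by split; [exact: (hx l).2|exact: (hx l).1].
have [p hp] := regular_coef d m (~~ b) l.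
by exists p => x hx; rewrite -hp // ffunE; case: b {hp}.
Qed.

End Automorphisms.

Section AutomorphismGroup.
Variables (k : fieldType) (n : nat) (D : complex n).
Local Notation A := (sr_ring k D).
Local Notation x_ := (sr_var k D).

Lemma sr_degM d e (f g : A) :
  sr_deg_le d f -> sr_deg_le e g -> sr_deg_le (d + e) (f * g).
Proof.
case=> p hp <- [q hq <-]; exists (p * q); last by rewrite rmorphM.
have [->|p0] := eqVneq p 0; first by rewrite mul0r msize0.
have [->|q0] := eqVneq q 0; first by rewrite mulr0 msize0.
rewrite msizeM //.
by have := leq_add hp hq; rewrite addSn addnS; case: (_ + _)%N.
Qed.

Lemma sr_deg1 : sr_deg_le 0 (1 : A).
Proof. by exists 1; rewrite ?msize1 ?rmorph1. Qed.

Lemma sr_degX d e (f : A) : sr_deg_le d f -> sr_deg_le (e * d) (f ^+ e).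
Proof.
move=> h; elim: e => [|e IH]; first by rewrite expr0; exact: sr_deg1.
by rewrite exprS mulSn; apply: sr_degM.
Qed.

Lemma sr_deg_prod (I : Type) (r : seq I) (f : I -> A) (d : I -> nat) :
  (forall i, sr_deg_le (d i) (f i)) ->
  sr_deg_le (\sum_(i <- r) d i) (\prod_(i <- r) f i).
Proof.
move=> h; elim: r => [|i r IH]; first by rewrite !big_nil; exact: sr_deg1.
by rewrite !big_cons; apply: sr_degM.
Qed.

Lemma sr_deg_sum (I : Type) (r : seq I) (f : I -> A) (c : I -> k) d :
  (forall i, sr_deg_le d (f i)) -> sr_deg_le d (\sum_(i <- r) c i *: f i).
Proof.
move=> h; elim: r => [|i r [q hq eq]].
  by rewrite big_nil; exists 0; rewrite ?msize0 ?raddf0.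
have [p hp ep] := h i; exists (c i *: p + q).
  by rewrite (leq_trans (msizeD_le _ _)) // geq_max hq (leq_trans (msizeZ_le _ _)).
by rewrite big_cons -eq -ep raddfD /= linearZ.
Qed.

Lemma aut_comp_deg d (f g : {lrmorphism A -> A}) :
  (forall l, sr_deg_le d (f (x_ l))) -> (forall l, sr_deg_le d (g (x_ l))) ->
  forall l, sr_deg_le (d * d) (f (g (x_ l))).
Proof.
move=> hf hg l; rewrite [g _](sr_degE (hg l)) hom_gen.
apply: sr_deg_sum => m; apply: (@sr_deg_mono _ _ _ (\sum_i m i * d)%N).
  by rewrite -big_distrl /= -mdegE leq_mul2r -ltnS bmdeg orbT.
by apply: sr_deg_prod => i; apply: sr_degX.
Qed.

Lemma comp_coef d b l m :
  exists p, forall x y : sr_aut k D, aut_piece d x -> aut_piece d y ->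
    sr_coef m (aut_dir x b (aut_dir y b (x_ l))) =
    peval p (pair_coord (aut_coord d x) (aut_coord d y)).
Proof.
have [p hp] : pfun (fun v : {ffun aut_index n d + aut_index n d -> k} =>
    sr_coef m (aut_subst D (fst_coord v) b
      (fun m' : 'X_{1..n < d.+1} => snd_coord v (b, l, m')))).
  apply: pfam_coef.
  apply: (@pfam_subst _ _ _ _ d d _ _ (fun m' v => snd_coord v (b, l, m'))).
    exact: pfun_fst.
  by move=> m'; apply: pfun_snd.
exists p => x y hx hy; rewrite -hp fst_pair snd_pair.
rewrite (aut_imageE b l hy) /aut_image hom_gen; congr sr_coef.
apply: eq_bigr => m' _; congr (_ *: _); apply: eq_bigr => i _.
by rewrite (aut_imageE b i hx).
Qed.

Lemma aut_ind_mul :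
  ind_morphism (ind_prod (aut_ind k D) (aut_ind k D)) (aut_ind k D)
    (fun x => (x.1 * x.2)%g).
Proof.
move=> d; exists (d * d)%N; split.
  case=> x y [/= hx hy] l.
  have [hx1 hx2] := (fun l => (hx l).1, fun l => (hx l).2).
  have [hy1 hy2] := (fun l => (hy l).1, fun l => (hy l).2).
  by split; apply: aut_comp_deg.
move=> [[b l] m]; have [p hp] := comp_coef d b l m; case: b hp => hp.
  by exists p => -[x y] [hx hy]; rewrite ffunE /=; exact: hp.
have [q hq] : pfun (fun v : {ffun aut_index n d + aut_index n d -> k} =>
    peval p (pair_coord (snd_coord v) (fst_coord v))).
  apply: (@pfun_comp _ _ _ (peval p)
    (fun v => pair_coord (snd_coord v) (fst_coord v))); first by exists p.
  case=> j.
    by have [r hr] := @pfun_snd k (aut_index n d) _ j; exists r => v; rewrite -hr ffunE.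
  by have [r hr] := @pfun_fst k _ (aut_index n d) j; exists r => v; rewrite -hr ffunE.
exists q => -[x y] [hx hy]; rewrite ffunE /= -hq fst_pair snd_pair; exact: hp.
Qed.

Definition aut_indGroup : indGroup k := IndGroup aut_ind_mul (@aut_ind_inv k n D).

End AutomorphismGroup.

Section TorusSym.
Variables (k : fieldType) (n : nat) (D : complex n).

Definition torus_sym : Type :=
  {x : {ffun 'I_n -> k} * 'S_n | [forall i, x.1 i != 0] && (x.2 \in complex_sym D)}.

HB.instance Definition _ := Choice.on torus_sym.

Lemma complex_symP (s : 'S_n) :
  reflect (forall F : {set 'I_n}, (s @: F \in faces D) = (F \in faces D))
          (s \in complex_sym D).
Proof.
rewrite inE; apply: (iffP eqP) => [e F|h].
  by rewrite -{1}e (mem_imset _ _ (imset_inj (@perm_inj _ s))).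
apply/setP=> F; apply/imsetP/idP => [[F' hF' ->]|hF]; first by rewrite h.
have sK : s @: (s^-1%g @: F) = F.
  by rewrite -imset_comp -[RHS]imset_id; apply: eq_imset => i /=; rewrite permKV.
by exists (s^-1%g @: F); rewrite ?sK // -h sK.
Qed.

Lemma complex_sym1 : 1%g \in complex_sym D.
Proof. apply/complex_symP=> F; rewrite (_ : _ @: F = F) // -[RHS]imset_id.
by apply: eq_imset => i; rewrite perm1. Qed.

Lemma complex_symM s t : s \in complex_sym D -> t \in complex_sym D ->
  (s * t)%g \in complex_sym D.
Proof.
move=> /complex_symP hs /complex_symP ht; apply/complex_symP=> F.
rewrite (_ : (s * t)%g @: F = t @: (s @: F)) ?ht ?hs // -imset_comp.
by apply: eq_imset => i; rewrite permM.
Qed.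

Lemma complex_symV s : s \in complex_sym D -> (s^-1)%g \in complex_sym D.
Proof.
move=> /complex_symP hs; apply/complex_symP=> F.
rewrite -hs (_ : s @: (s^-1%g @: F) = F) // -imset_comp -[RHS]imset_id.
by apply: eq_imset => i /=; rewrite permKV.
Qed.

Lemma ts_eq (x y : torus_sym) :
  (forall i, (val x).1 i = (val y).1 i) -> (val x).2 = (val y).2 -> x = y.
Proof.
move=> h1 h2; apply: val_inj; case: (val x) (val y) h1 h2 => [t s] [t' s'] /= h1 ->.
by congr pair; apply/ffunP.
Qed.

Lemma ts_neq0 (x : torus_sym) i : (val x).1 i != 0.
Proof. by have /andP[/forallP] := valP x. Qed.

Lemma ts_sym (x : torus_sym) : (val x).2 \in complex_sym D.
Proof. by have /andP[] := valP x. Qed.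

Lemma ts_proof (t : {ffun 'I_n -> k}) (s : 'S_n) :
  (forall i, t i != 0) -> s \in complex_sym D ->
  [forall i, (t, s).1 i != 0] && ((t, s).2 \in complex_sym D).
Proof. by move=> h ->; rewrite andbT; apply/forallP. Qed.

Lemma ts_one_proof : [forall i, ([ffun=> 1 : k] : {ffun 'I_n -> k}) i != 0].
Proof. by apply/forallP=> i; rewrite ffunE oner_neq0. Qed.

Definition ts_one : torus_sym :=
  exist _ ([ffun=> 1], 1%g)
    (ts_proof (fun i => forallP ts_one_proof i) complex_sym1).

Lemma ts_mul_proof (x y : torus_sym) i :
  ([ffun i => (val x).1 i * (val y).1 (((val x).2^-1)%g i)] : {ffun 'I_n -> k}) i != 0.
Proof. by rewrite ffunE mulf_neq0 ?ts_neq0. Qed.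

(* (t, s)(t', s') = (t s(t'), s o s'), where s(t')_i = t'_{s^-1(i)}; note that
   (s' * s)%g is the composite s o s'. *)
Definition ts_mul (x y : torus_sym) : torus_sym :=
  exist _ ([ffun i => (val x).1 i * (val y).1 (((val x).2^-1)%g i)],
           ((val y).2 * (val x).2)%g)
    (ts_proof (ts_mul_proof x y) (complex_symM (ts_sym y) (ts_sym x))).

Lemma ts_inv_proof (x : torus_sym) i :
  ([ffun i => ((val x).1 ((val x).2 i))^-1] : {ffun 'I_n -> k}) i != 0.
Proof. by rewrite ffunE invr_eq0 ts_neq0. Qed.

Definition ts_inv (x : torus_sym) : torus_sym :=
  exist _ ([ffun i => ((val x).1 ((val x).2 i))^-1], ((val x).2^-1)%g)
    (ts_proof (ts_inv_proof x) (complex_symV (ts_sym x))).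

Lemma ts_mulA : associative ts_mul.
Proof.
move=> x y z; apply: ts_eq => [i|] /=; last by rewrite mulgA.
by rewrite !ffunE mulrA invMg permM.
Qed.
Lemma ts_mul1 : left_id ts_one ts_mul.
Proof.
move=> x; apply: ts_eq => [i|] /=; last by rewrite mulg1.
by rewrite !ffunE mul1r invg1 perm1.
Qed.
Lemma ts_1mul : right_id ts_one ts_mul.
Proof.
move=> x; apply: ts_eq => [i|] /=; last by rewrite mul1g.
by rewrite !ffunE mulr1.
Qed.
Lemma ts_mulV : left_inverse ts_one ts_inv ts_mul.
Proof.
move=> x; apply: ts_eq => [i|] /=; last by rewrite mulgV.
by rewrite !ffunE invgK mulVf ?ts_neq0.
Qed.
Lemma ts_Vmul : right_inverse ts_one ts_inv ts_mul.
Proof.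
move=> x; apply: ts_eq => [i|] /=; last by rewrite mulVg.
by rewrite !ffunE permKV mulfV ?ts_neq0.
Qed.

HB.instance Definition _ := isGroup.Build torus_sym
  ts_mulA ts_mul1 ts_1mul ts_mulV ts_Vmul.

(* The coordinates t_i and t_i^-1 of the torus, and the characteristic
   functions of the elements of the finite group. *)
Definition ts_index : finType := ('I_n + 'I_n + 'S_n)%type.

Definition ts_coord (x : torus_sym) : {ffun ts_index -> k} :=
  [ffun j : ts_index => match j return k with
   | inl (inl i) => (val x).1 i
   | inl (inr i) => ((val x).1 i)^-1
   | inr s => ((val x).2 == s)%:R
   end].

Lemma ts_coord_inj x y : True -> True -> ts_coord x = ts_coord y -> x = y.
Proof.
move=> _ _ /ffunP e; apply: ts_eq => [i|].
  by have := e (inl (inl i)); rewrite !ffunE.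
have := e (inr (val x).2); rewrite !ffunE eqxx.
by case: ((val y).2 =P (val x).2) => // _ /eqP; rewrite oner_eq0.
Qed.

Definition ts_eqs (v : {ffun ts_index -> k}) : Prop :=
  [/\ forall i, v (inl (inl i)) * v (inl (inr i)) - 1 = 0,
      forall s, s \notin complex_sym D -> v (inr s) = 0,
      forall st : 'S_n * 'S_n, st.1 != st.2 -> v (inr st.1) * v (inr st.2) = 0 &
      \sum_s v (inr s) - 1 = 0].

Lemma ts_eqsP v : (exists2 x, True & ts_coord x = v) <-> ts_eqs v.
Proof.
split=> [[x _ <-]|[h1 h2 h3 h4]].
  split=> [i|s hs|[s t] /= ne|].
  - by rewrite !ffunE mulfV ?subrr ?ts_neq0.
  - by rewrite ffunE; case: eqP => // e; rewrite -e ts_sym in hs.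
  - rewrite !ffunE; case: eqP => [->|]; last by rewrite mul0r.
    by rewrite (negPf ne) mulr0.
  rewrite (bigD1 (val x).2) //= ffunE eqxx big1 ?addr0 ?subrr // => s ne.
  by rewrite ffunE eq_sym (negPf ne).
have [s hs] : exists s, v (inr s) != 0.
  apply: contrapT => h; move/eqP: h4; rewrite big1 ?sub0r ?oppr_eq0 ?oner_eq0 //.
  by move=> s _; apply/eqP; apply: contrapT => hs; apply: h; exists s; apply/negP.
have h0 t : t != s -> v (inr t) = 0.
  by move=> ne; have /eqP := h3 (t, s) ne; rewrite mulf_eq0 (negPf hs) orbF => /eqP.
have hs1 : v (inr s) = 1.
  by move/eqP: h4; rewrite (bigD1 s) //= big1 ?addr0 // subr_eq0 => /eqP.
have ht i : v (inl (inl i)) != 0.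
  apply: contraTneq (oner_neq0 k) => e; rewrite negbK.
  by have /eqP := h1 i; rewrite e mul0r sub0r oppr_eq0.
have hS : s \in complex_sym D by apply: contraNT hs => /h2 ->.
have ht' i : [ffun i => v (inl (inl i))] i != 0 by rewrite ffunE.
pose x : torus_sym := exist _ ([ffun i => v (inl (inl i))], s) (ts_proof ht' hS).
exists x => //.
apply/ffunP=> -[[i|i]|t]; rewrite !ffunE /= ?ffunE //.
  by apply: (mulfI (ht i)); have /eqP := h1 i; rewrite subr_eq0 mulfV // => /eqP.
by case: eqP => [<-//|/eqP ne]; rewrite h0 // eq_sym.
Qed.

Lemma ts_closed : zariski_closed (fun v => exists2 x, True & ts_coord x = v).
Proof.
apply: (@zariski_closed_ext _ _ ts_eqs) => [v|]; first by rewrite ts_eqsP.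
have c1 : zariski_closed (fun v : {ffun ts_index -> k} =>
    forall i, True -> v (inl (inl i)) * v (inl (inr i)) - 1 = 0).
  apply: (@zariski_closed_pfun _ _ _ (fun=> True)
    (fun i v => v (inl (inl i)) * v (inl (inr i)) - 1)) => // i _.
  by apply: pfunB; [apply: pfunM; apply: pfun_coord|apply: pfunC].
pose P2 (s : 'S_n) : Prop := s \notin complex_sym D.
have c2 : zariski_closed (fun v : {ffun ts_index -> k} =>
    forall s, P2 s -> v (inr s) = 0).
  by apply: (@zariski_closed_pfun _ _ _ P2 (fun s v => v (inr s))) => // s _;
    apply: pfun_coord.
pose P3 (s : 'S_n * 'S_n) : Prop := s.1 != s.2.
have c3 : zariski_closed (fun v : {ffun ts_index -> k} =>
    forall s, P3 s -> v (inr s.1) * v (inr s.2) = 0).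
  by apply: (@zariski_closed_pfun _ _ _ P3 (fun s v => v (inr s.1) * v (inr s.2))) => // s _;
    apply: pfunM; apply: pfun_coord.
have c4 : zariski_closed (fun v : {ffun ts_index -> k} =>
    forall u : unit, True -> \sum_s v (inr s) - 1 = 0).
  apply: (@zariski_closed_pfun _ _ unit (fun=> True) (fun _ v => \sum_s v (inr s) - 1)) => // _ _.
  apply: pfunB; last exact: pfunC.
  by apply: (@pfun_sum _ _ _ (fun s v => v (inr s))) => s; apply: pfun_coord.
apply: zariski_closed_ext (zariski_closedI (zariski_closedI c1 c2) (zariski_closedI c3 c4)) => v.
split=> [[[h1 h2] [h3 h4]]|[h1 h2 h3 h4]].
  by split=> // [i|]; [exact: h1|exact: (h4 tt)].
by split; split=> // i _; apply: h1.
Qed.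

Definition ts_variety : affineVariety k (fun _ : torus_sym => True) :=
  AffineVariety ts_coord_inj ts_closed.

Definition ts_ind : indVariety k torus_sym := const_ind ts_variety.

Lemma ts_coord_sum (x : torus_sym) (f : 'S_n -> k) :
  f (val x).2 = \sum_s ts_coord x (inr s) * f s.
Proof.
rewrite (bigD1 (val x).2) //= ffunE eqxx mul1r big1 ?addr0 // => s ne.
by rewrite ffunE eq_sym (negPf ne) mul0r.
Qed.

Lemma ts_ind_inv : ind_morphism ts_ind ts_ind (fun x => (x^-1)%g).
Proof.
move=> d; exists 0%N; split=> // -[[i|i]|s].
- have [p hp] : pfun (fun v : {ffun ts_index -> k} =>
      \sum_s v (inr s) * v (inl (inr (s i)))).
    apply: (@pfun_sum _ _ _ (fun s v => v (inr s) * v (inl (inr (fun_of_perm s i))))) => s.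
    by apply: pfunM; apply: pfun_coord.
  exists p => x _; rewrite -hp [LHS]ffunE /= ffunE.
  rewrite (ts_coord_sum x (fun s => ((val x).1 (s i))^-1)).
  by apply: eq_bigr => s _; rewrite [ts_coord x (inl _)]ffunE.
- have [p hp] : pfun (fun v : {ffun ts_index -> k} =>
      \sum_s v (inr s) * v (inl (inl (s i)))).
    apply: (@pfun_sum _ _ _ (fun s v => v (inr s) * v (inl (inl (fun_of_perm s i))))) => s.
    by apply: pfunM; apply: pfun_coord.
  exists p => x _; rewrite -hp [LHS]ffunE /= ffunE invrK.
  rewrite (ts_coord_sum x (fun s => (val x).1 (s i))).
  by apply: eq_bigr => s _; rewrite [ts_coord x (inl _)]ffunE.
have [p hp] := pfun_coord k (inr (s^-1)%g : ts_index).
by exists p => x _; rewrite -hp !ffunE /= -(inj_eq invg_inj) invgK.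
Qed.

Lemma ts_ind_mul :
  ind_morphism (ind_prod ts_ind ts_ind) ts_ind (fun x => (x.1 * x.2)%g).
Proof.
move=> d; exists 0%N; split=> // -[[i|i]|s].
- have [p hp] : pfun (fun v : {ffun ts_index + ts_index -> k} =>
      v (inl (inl (inl i))) *
      \sum_s v (inl (inr s)) * v (inr (inl (inl ((s^-1)%g i))))).
    apply: pfunM; first exact: pfun_coord.
    apply: (@pfun_sum _ _ _ (fun s v => v (inl (inr s)) *
      v (inr (inl (inl (fun_of_perm (s^-1)%g i)))))) => s.
    by apply: pfunM; apply: pfun_coord.
  exists p => -[x y] _; rewrite -hp [LHS]ffunE /= ffunE; congr (_ * _).
    by rewrite !ffunE.
  rewrite /= (ts_coord_sum x (fun s => (val y).1 ((s^-1)%g i))).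
  by apply: eq_bigr => s _; rewrite !ffunE.
- have [p hp] : pfun (fun v : {ffun ts_index + ts_index -> k} =>
      v (inl (inl (inr i))) *
      \sum_s v (inl (inr s)) * v (inr (inl (inr ((s^-1)%g i))))).
    apply: pfunM; first exact: pfun_coord.
    apply: (@pfun_sum _ _ _ (fun s v => v (inl (inr s)) *
      v (inr (inl (inr (fun_of_perm (s^-1)%g i)))))) => s.
    by apply: pfunM; apply: pfun_coord.
  exists p => -[x y] _; rewrite -hp [LHS]ffunE /= ffunE invfM; congr (_ * _).
    by rewrite !ffunE.
  rewrite /= (ts_coord_sum x (fun s => ((val y).1 ((s^-1)%g i))^-1)).
  by apply: eq_bigr => s _; rewrite !ffunE.
have [p hp] : pfun (fun v : {ffun ts_index + ts_index -> k} =>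
    \sum_t v (inl (inr t)) * v (inr (inr (s * t^-1)%g))).
  apply: (@pfun_sum _ _ _ (fun t v => v (inl (inr t)) * v (inr (inr (s * t^-1)%g)))) => t.
  by apply: pfunM; apply: pfun_coord.
exists p => -[x y] _; rewrite -hp ffunE /=.
rewrite (ts_coord_sum x (fun t => ((val y).2 * t == s)%g%:R)).
by apply: eq_bigr => t _; rewrite !ffunE (can2_eq (mulgK t) (mulgKV t)).
Qed.

Definition ts_indGroup : indGroup k := IndGroup ts_ind_mul ts_ind_inv.

End TorusSym.

Section Rigidity.
Variables (k : fieldType) (n : nat) (D : complex n).
Local Notation A := (sr_ring k D).

(* A regular action of the additive group on Spec A is a coaction of k[t] on A:
   a homomorphism of k-algebras A -> A[t] which is counital and coassociative,
   the comultiplication k[t] -> k[t, u] being t |-> t + u. *)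
Definition Ga_action (rho : {rmorphism A -> {poly A}}) : Prop :=
  [/\ forall c : k, rho c%:A = (c%:A)%:P,
      forall f : A, (rho f).[0] = f &
      forall f : A, map_poly rho (rho f) = poly_XaY (rho f)].

Definition Ga_trivial (rho : {rmorphism A -> {poly A}}) : Prop :=
  forall f : A, rho f = f%:P.

Definition rigid : Prop := forall rho, Ga_action rho -> Ga_trivial rho.

End Rigidity.

(* Main.v *)
From HB Require Import structures.
Require Import Defs.
From mathcomp Require Import all_boot all_order all_fingroup all_algebra.
From mathcomp Require Import generic_quotient boolp mpoly.

Set Implicit Arguments.
Unset Strict Implicit.
Unset Printing Implicit Defensive.

Import GRing.Theory.
Local Open Scope ring_scope.

(** Rigidity of X_D is a property of the ind-group Aut(X_D): it says that every
    one-parameter subgroup, i.e. every homomorphism psi : k -> Aut(X_D) which is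
    a polynomial curve, is trivial ([rigidP]).  This property of an ind-group is
    visibly invariant under isomorphisms ([no_Ga_subgroup_iso]), so a rigid and
    a non-rigid variety cannot have isomorphic automorphism ind-groups.

    The equivalence is pointwise: over an infinite field an element P of A[t] is
    determined by its values P(a), a in k ([sr_poly_fun_eq0]).  Evaluating a
    coaction rho : A -> A[t] at t = a gives an automorphism of A, and these form
    a one-parameter subgroup ([ga_aut_one_param]).  Conversely, along a
    one-parameter subgroup psi the image psi_a(f) of each f is a polynomial in a,
    and the map rho sending f to this polynomial is a ring morphism, counital
    and coassociative because all these identities hold at each point
    ([one_param_action]).

    For the torus extension, a polynomial curve in it is constant: a polynomial
    without zeros is constant, and so is a polynomial which takes only the
    values 0 and 1 ([ts_curve_const]).  Hence Aut(X_D) being isomorphic to the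
    torus extension makes X_D rigid.  If S does not contain i but each facet
    over S does, then x_i |-> x_i + a x^S, with the other variables fixed, is a
    nontrivial one-parameter subgroup of Aut(X_D) ([exposing_not_rigid]); so a
    rigid D is fully hidden and a fully exposed D is never rigid.

    If no X_D were rigid, the empty assignment would refute the last claim.  The union
    of the n coordinate axes, n > 1, is rigid ([discrete_rigid]): a coaction
    preserves each axis and the origin, hence acts on each axis by
    x |-> c(a) x, where c is a polynomial without zeros and c(0) = 1. *)

(** * Polynomials over an algebraically closed field, as functions *)

Section PolyFun.
Variable k : closedFieldType.
Implicit Types p : {poly k}.

Lemma poly_nonvanishing_const p : (forall a, p.[a] != 0) -> p = (p.[0])%:P.
Proof.
move=> h; have [/eq_leq/size1_polyC e|/closed_rootP[a /eqP ea]] :=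
  eqVneq (size p) 1%N; first by rewrite {2}e hornerC.
by have := h a; rewrite ea eqxx.
Qed.

(** Such a p makes p + 1 a polynomial without zeros, hence a constant. *)
Lemma poly_fun_eq0 p : (forall a, p.[a] = 0) -> p = 0.
Proof.
move=> h; have h1 a : (p + 1).[a] = 1 by rewrite hornerD hornerC h add0r.
have /poly_nonvanishing_const : forall a, (p + 1).[a] != 0.
  by move=> a; rewrite h1 oner_neq0.
by rewrite h1 => /(canRL (addrK _)) ->; rewrite subrr.
Qed.

Lemma poly_bool_const p (b : k -> bool) :
  (forall a, p.[a] = (b a)%:R) -> p = (p.[0])%:P.
Proof.
move=> h; have /poly_fun_eq0/eqP : forall a, (p * (p - 1)).[a] = 0.
  by move=> a; rewrite !hornerE h; case: (b a); rewrite ?subrr ?mulr0 ?mul0r.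
by rewrite mulf_eq0 subr_eq0 => /orP[]/eqP->; rewrite hornerC.
Qed.

End PolyFun.

(** * Morphisms and coefficients on a Stanley-Reisner ring *)

Section CoordinateRing.
Variables (k : fieldType) (n : nat) (D : complex n).
Local Notation A := (sr_ring k D).
Local Notation x_ := (sr_var k D).

Lemma sr_var_prod_nonface (s : {set 'I_n}) :
  s \notin faces D -> \prod_(i in s) x_ i = 0.
Proof.
move=> hs; rewrite -rmorph_prod -(raddf0 (sr_pi D)); apply/sr_pi_eq; rewrite subr0.
apply/asboolP; exists (fun t => (t == s)%:R).
rewrite (bigD1 s) //= eqxx mul1r [X in _ = _ + X]big1 ?addr0 // => t.
by case/andP=> _ /negPf->; rewrite mul0r.
Qed.

Lemma sr_rmorph_ext (B : comNzRingType) (f g : {rmorphism A -> B}) :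
  (forall c : k, f c%:A = g c%:A) -> (forall i, f (x_ i) = g (x_ i)) -> f =1 g.
Proof.
move=> hc h x; rewrite -[x]sr_reprK [repr x]mpolyE !raddf_sum /=.
apply: eq_bigr => m _; rewrite linearZ /= -mulr_algl.
rewrite [LHS](rmorphM f) [RHS](rmorphM g) hc; congr (_ * _).
rewrite mpolyXE_id !rmorph_prod /=; apply: eq_bigr => i _.
by rewrite !rmorphXn /= h.
Qed.

Section Lift.
Variables (B : comNzRingType) (h : {rmorphism k -> B}) (y : 'I_n -> B).
Hypothesis y0 : forall s : {set 'I_n}, s \notin faces D -> \prod_(i in s) y i = 0.

Definition lift_to (f : A) : B := mmap h y (repr f).

Let lift_to_pi p : lift_to (sr_pi D p) = mmap h y p.
Proof.
apply/eqP; rewrite -subr_eq0 /lift_to -raddfB.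
have /sr_pi_eq/asboolP[q ->] : sr_pi D (repr (sr_pi D p)) = sr_pi D p.
  exact: sr_reprK.
rewrite raddf_sum big1 //= => s hs.
rewrite rmorphM rmorph_prod /= (eq_bigr y) ?y0 ?mulr0 // => i _.
by rewrite mmapX mmap1U.
Qed.

Let lift_toB : {morph lift_to : f g / f - g}.
Proof.
move=> f g; rewrite -[f]sr_reprK -[g]sr_reprK -rmorphB !lift_to_pi.
exact: raddfB.
Qed.

Let lift_to_monoid : monoid_morphism lift_to.
Proof.
split=> [|f g]; first by rewrite -(rmorph1 (sr_pi D)) lift_to_pi rmorph1.
rewrite -[f]sr_reprK -[g]sr_reprK -rmorphM !lift_to_pi; exact: rmorphM.
Qed.

HB.instance Definition _ := GRing.isZmodMorphism.Build _ _ lift_to lift_toB.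
HB.instance Definition _ := GRing.isMonoidMorphism.Build _ _ lift_to lift_to_monoid.

(** The universal property of k[D] with values in an arbitrary commutative ring;
    it is needed for maps to k[x]. *)
Lemma sr_lift_to : exists f : {rmorphism A -> B},
  [/\ forall i, f (x_ i) = y i, forall c : k, f c%:A = h c &
      forall p, f (sr_pi D p) = mmap h y p].
Proof.
exists (lift_to : {rmorphism A -> B}); split=> [i|c|p] /=; rewrite ?lift_to_pi //.
  by rewrite mmapX mmap1U.
by rewrite -(rmorph1 (sr_pi D)) -linearZ /= lift_to_pi -mul_mpolyC mulr1 mmapC.
Qed.

End Lift.

Section Coef.
Variable m : 'X_{1..n}.

Let coefB : {morph (@sr_coef k n D m) : f g / f - g}.
Proof. by move=> f g; exact: sr_coefB. Qed.
HB.instance Definition _ := GRing.isZmodMorphism.Build A k (sr_coef m) coefB.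

Lemma sr_coefD (f g : A) : sr_coef m (f + g) = sr_coef m f + sr_coef m g.
Proof. exact: raddfD. Qed.

Lemma sr_coefZ (c : k) (f : A) : sr_coef m (c *: f) = c * sr_coef m f.
Proof.
rewrite -[f]sr_reprK -linearZ !sr_coef_pi mcoeffZ.
by case: ifP; rewrite ?mulr0.
Qed.

Lemma sr_coef_sum (I : Type) (r : seq I) (F : I -> A) :
  sr_coef m (\sum_(i <- r) F i) = \sum_(i <- r) sr_coef m (F i).
Proof. exact: raddf_sum. Qed.

(** Taking one coefficient turns an identity in A[t] into one in k[t]. *)
Lemma sr_coef_horner (P : {poly A}) (a : k) :
  sr_coef m P.[a%:A] = (map_poly (sr_coef m) P).[a].
Proof.
rewrite (horner_coef_wide _ (size_poly _ _)) horner_coef sr_coef_sum.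
apply: eq_bigr => i _; rewrite coef_map_id0 ?sr_coef0 //.
by rewrite exprZn expr1n mulr_algr sr_coefZ mulrC.
Qed.

End Coef.

End CoordinateRing.

(** * Identities over k[D] checked at the points of the line *)

Section PointwiseVanishing.
Variables (k : closedFieldType) (n : nat) (D : complex n).
Local Notation A := (sr_ring k D).

Lemma sr_poly_fun_eq0 (P : {poly A}) : (forall a : k, P.[a%:A] = 0) -> P = 0.
Proof.
move=> h; apply/polyP => i; apply: sr_coef_inj => m.
rewrite coef0 sr_coef0 -(coef_map_id0 _ _ (sr_coef0 k D m)).
rewrite (poly_fun_eq0 (p := map_poly _ P)) ?coef0 // => a.
by rewrite -sr_coef_horner h sr_coef0.
Qed.

(** For fixed a the value at a vanishes by the one-variable case; the j-th
    coefficients of the coefficients of Q then form a polynomial vanishing at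
    every a. *)
Lemma sr_poly2_fun_eq0 (Q : {poly {poly A}}) :
  (forall a b : k, Q.[(a%:A)%:P].[b%:A] = 0) -> Q = 0.
Proof.
move=> h; apply/polyP => i; apply/polyP => j; rewrite !coef0.
have e : map_poly (coefp j) Q = 0.
  apply: sr_poly_fun_eq0 => a.
  transitivity (coefp j Q.[(a%:A)%:P]); last first.
    by rewrite (sr_poly_fun_eq0 (P := Q.[_])) ?raddf0.
  rewrite (horner_coef_wide _ (size_poly _ _)) horner_coef raddf_sum.
  by apply: eq_bigr => l _; rewrite coef_map /= -rmorphXn coefMC.
by have := congr1 (fun p : {poly A} => p`_i) e; rewrite coef_map coef0.
Qed.

Lemma horner_XaY (p : {poly A}) (c d : A) :
  (poly_XaY p).[c%:P].[d] = p.[c + d].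
Proof.
rewrite /poly_XaY horner_comp hornerD hornerX hornerC.
by rewrite -[_.[_ + _]]/(p \Po (c%:P + 'X)) horner_comp hornerD hornerX hornerC.
Qed.

End PointwiseVanishing.

(** * One-parameter subgroups of ind-groups *)

Section OneParameterSubgroups.
Variable k : closedFieldType.

(** A morphism of ind-varieties from the affine line: as the line is a single
    variety, it lands in one piece, where its coordinates are polynomials. *)
Definition poly_curve (T : Type) (V : indVariety k T) (psi : k -> T) : Prop :=
  exists2 d, forall a, iv_piece V d (psi a) &
    forall j, exists p : {poly k}, forall a,
      av_coord (iv_variety V d) (psi a) j = p.[a].

Lemma poly_curve_comp (T T' : Type) (V : indVariety k T) (V' : indVariety k T')
    (f : T -> T') (psi : k -> T) :
  ind_morphism V V' f -> poly_curve V psi -> poly_curve V' (f \o psi).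
Proof.
move=> hf [d hd /choice[q hq]]; have [e [he hr]] := hf d.
exists e => [a|j]; first exact/he/hd.
have [p hp] := hr j.
exists (mmap polyC (fun i => q (enum_val i)) p) => a.
rewrite hp // /peval /meval /mmap horner_sum; apply: eq_bigr => m _.
rewrite hornerM hornerC /mmap1 horner_prod; congr (_ * _).
by apply: eq_bigr => i _; rewrite horner_exp hq.
Qed.

Definition one_param (G : indGroup k) (psi : k -> G) : Prop :=
  poly_curve (ig_variety G) psi /\ forall a b, psi (a + b) = (psi a * psi b)%g.

Definition no_Ga_subgroup (G : indGroup k) : Prop :=
  forall psi : k -> G, one_param psi -> forall a, psi a = 1%g.

Lemma ind_isomorphic_sym (G H : indGroup k) :
  ind_isomorphic G H -> ind_isomorphic H G.
Proof.
case=> f [g [fK gK fM hf hg]]; exists g, f; split=> // x y.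
by apply: (can_inj fK); rewrite fM !gK.
Qed.

Lemma no_Ga_subgroup_iso (G H : indGroup k) :
  ind_isomorphic G H -> no_Ga_subgroup H -> no_Ga_subgroup G.
Proof.
case=> f [g [fK gK fM hf hg]] hH psi [hc hM] a.
have f1 : f 1%g = 1%g by apply: (mulgI (f 1%g)); rewrite -fM !mulg1.
apply: (can_inj fK); rewrite f1; apply: (hH (f \o psi)); split.
  exact: poly_curve_comp hf hc.
by move=> b c; rewrite /= hM fM.
Qed.

End OneParameterSubgroups.

(** * The one-parameter subgroup of an action of the additive group *)

Section ActionPoints.
Variables (k : closedFieldType) (n : nat) (D : complex n).
Local Notation A := (sr_ring k D).
Local Notation x_ := (sr_var k D).
Variable rho : {rmorphism A -> {poly A}}.
Hypothesis rhoG : Ga_action rho.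

(** The comorphism of the action of the element a of the additive group. *)
Definition ga_point (a : k) (f : A) : A := (rho f).[a%:A].

Let ga_pointB a : {morph ga_point a : f g / f - g}.
Proof. by move=> f g; rewrite /ga_point rmorphB hornerD hornerN. Qed.
Let ga_point_monoid a : monoid_morphism (ga_point a).
Proof.
by split=> [|f g]; rewrite /ga_point ?rmorph1 ?hornerC // rmorphM hornerM.
Qed.
Let ga_pointZ a : scalable (ga_point a).
Proof.
move=> c f; have [hc _ _] := rhoG.
by rewrite /ga_point -(mulr_algl c f) (rmorphM rho) hornerM hc hornerC mulr_algl.
Qed.

HB.instance Definition _ a :=
  GRing.isZmodMorphism.Build A A (ga_point a) (ga_pointB a).
HB.instance Definition _ a :=
  GRing.isMonoidMorphism.Build A A (ga_point a) (ga_point_monoid a).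
HB.instance Definition _ a :=
  GRing.isScalable.Build k A A _ (ga_point a) (ga_pointZ a).

Lemma ga_point0 f : ga_point 0 f = f.
Proof. by rewrite /ga_point scale0r; have [_ ->] := rhoG. Qed.

(** Coassociativity, with the two parameters evaluated at a and b. *)
Lemma ga_pointD a b f : ga_point (a + b) f = ga_point b (ga_point a f).
Proof.
have [hc _ /(_ f) e] := rhoG.
rewrite /ga_point scalerDl -horner_XaY -e.
by rewrite -hc horner_map.
Qed.

Lemma ga_pointK a : cancel (ga_point a) (ga_point (- a)).
Proof. by move=> f; rewrite -ga_pointD subrr ga_point0. Qed.
Lemma ga_pointNK a : cancel (ga_point (- a)) (ga_point a).
Proof. by move=> f; rewrite -ga_pointD addNr ga_point0. Qed.

Definition ga_aut (a : k) : aut_indGroup k D :=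
  @SrAut k n D (ga_point a : {lrmorphism A -> A})
    (ga_point (- a) : {lrmorphism A -> A}) (@ga_pointK a) (@ga_pointNK a).

(** The degrees stay bounded since the rho(x_l) have finitely many coefficients
    altogether; this puts all the points of the action in a single piece. *)
Lemma ga_point_deg : exists d, forall a l, sr_deg_le d (ga_point a (x_ l)).
Proof.
pose N := (\max_l size (rho (x_ l)))%N.
have [d hd] := sr_deg_bound (fun u : 'I_n * 'I_N => (rho (x_ u.1))`_u.2).
exists d => a l; rewrite /ga_point (@horner_coef_wide _ N); last first.
  exact: (leq_bigmax (F := fun l => size (rho (x_ l)))).
under eq_bigr => i _ do rewrite exprZn expr1n mulr_algr.
by apply: sr_deg_sum => i; apply: (hd (l, i)).
Qed.

Lemma ga_aut_one_param : one_param ga_aut.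
Proof.
have [d hd] := ga_point_deg; split; last first.
  by move=> a b; apply: sr_aut_eq => f /=; rewrite addrC ga_pointD.
exists d => [a l|[[b l] m]]; first by split; exact: hd.
exists (map_poly (sr_coef m) (rho (x_ l)) \Po (if b then 'X else - 'X)) => a.
rewrite ffunE horner_comp.
by case: b; rewrite /= /ga_point ?hornerN hornerX sr_coef_horner.
Qed.

End ActionPoints.

(** * Rigidity as a property of the automorphism ind-group *)

Section Rigidity.
Variables (k : closedFieldType) (n : nat) (D : complex n).
Local Notation A := (sr_ring k D).
Local Notation x_ := (sr_var k D).

(** The axioms of a ring morphism are identities in A[t], so they can be checked
    at each point t = a, where they hold for psi a. *)
Lemma points_rmorphism (r : A -> {poly A}) (psi : k -> {lrmorphism A -> A}) :
  (forall a f, (r f).[a%:A] = psi a f) ->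
  exists rho : {rmorphism A -> {poly A}}, forall f, rho f = r f.
Proof.
move=> rE.
have rB : {morph r : f g / f - g}.
  move=> f g; apply/eqP; rewrite -subr_eq0; apply/eqP/sr_poly_fun_eq0 => a.
  by rewrite !(hornerD, hornerN) !rE raddfB subrr.
have rM : monoid_morphism r.
  split=> [|f g]; apply/eqP; rewrite -subr_eq0; apply/eqP/sr_poly_fun_eq0 => a.
    by rewrite !(hornerD, hornerN) hornerC rE rmorph1 subrr.
  by rewrite !(hornerD, hornerN, hornerM) !rE rmorphM subrr.
pose zr := GRing.isZmodMorphism.Build A {poly A} r rB.
pose mr := GRing.isMonoidMorphism.Build A {poly A} r rM.
pose rho : {rmorphism A -> {poly A}} := HB.pack r zr mr.
by exists rho.
Qed.

(** The coordinates of psi a are polynomials in a, so this holds for f = x_l; the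
    general f is a polynomial in the x_l. *)
Lemma one_param_image (psi : k -> aut_indGroup k D) (f : A) :
  one_param psi -> exists P : {poly A}, forall a, P.[a%:A] = aut_fun (psi a) f.
Proof.
case=> -[d hd /choice[q hq]] _.
pose P l := \sum_(m : 'X_{1..n < d.+1})
  map_poly (in_alg A) (q (true, l, m)) * (sr_pi D 'X_[m])%:P.
have hP a l : (P l).[a%:A] = aut_fun (psi a) (x_ l).
  rewrite -[aut_fun _]/(aut_dir (psi a) true) (aut_imageE true l (hd a)).
  rewrite horner_sum; apply: eq_bigr => m _.
  by rewrite hornerM hornerC -in_algE horner_map -hq /= mulr_algl.
have [e he] := sr_deg_ex f; rewrite (sr_degE he).
exists (\sum_(m : 'X_{1..n < e.+1}) (sr_coef m f)%:A%:P * \prod_i P i ^+ m i) => a.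
rewrite hom_gen horner_sum; apply: eq_bigr => m _.
rewrite hornerM hornerC mulr_algl horner_prod; congr (_ *: _).
by apply: eq_bigr => i _; rewrite horner_exp hP.
Qed.

Lemma one_param_action (psi : k -> aut_indGroup k D) :
  one_param psi -> exists2 rho : {rmorphism A -> {poly A}}, Ga_action rho &
    forall a f, (rho f).[a%:A] = aut_fun (psi a) f.
Proof.
move=> hpsi; have [_ hD] := hpsi.
have psi0 : psi 0 = 1%g by apply: (mulgI (psi 0)); rewrite -hD addr0 mulg1.
have /choice[r rE] := fun f => one_param_image f hpsi.
have [rho hrho] := points_rmorphism (fun a f => rE f a).
have {r hrho}rE a f : (rho f).[a%:A] = aut_fun (psi a) f by rewrite hrho rE.
have rc (c : k) : rho c%:A = (c%:A)%:P.
  apply/eqP; rewrite -subr_eq0; apply/eqP/sr_poly_fun_eq0 => a.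
  by rewrite hornerD hornerN hornerC rE linearZ /= rmorph1 subrr.
exists rho => //; split=> [c|f|f]; first exact: rc.
  by rewrite -(scale0r (1 : A)) rE psi0.
apply/eqP; rewrite -subr_eq0; apply/eqP/sr_poly2_fun_eq0 => a b.
rewrite !(hornerD, hornerN) horner_XaY -scalerDl.
have := rc a; rewrite /= => <-.
by rewrite horner_map /= !rE (addrC a b) hD subrr.
Qed.

Lemma rigidP : rigid k D <-> no_Ga_subgroup (aut_indGroup k D).
Proof.
split=> [hr psi hpsi a|h rho hrho f].
  have [rho /hr hrho rE] := one_param_action hpsi.
  by apply: sr_aut_eq => f; rewrite -rE hrho hornerC.
apply/eqP; rewrite -subr_eq0; apply/eqP/sr_poly_fun_eq0 => a.
have := congr1 (fun x : sr_aut k D => aut_fun x f) (h _ (ga_aut_one_param hrho) a).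
by rewrite /= /ga_point hornerD hornerN hornerC => ->; rewrite subrr.
Qed.

End Rigidity.

(** * The extension of the torus by the symmetries *)

Section ConstantCurves.
Variables (k : closedFieldType) (n : nat) (D : complex n).

(** The torus coordinates are polynomials without zeros, and the indicator of
    the permutation part of psi 0 is a polynomial with values 0 and 1. *)
Lemma ts_curve_const (psi : k -> torus_sym k D) :
  poly_curve (ts_ind k D) psi -> forall a, psi a = psi 0.
Proof.
case=> d _ h a.
have {}h j : exists p : {poly k}, forall a, ts_coord (psi a) j = p.[a].
  exact: (h j).
apply: ts_eq => [i|].
  have [p hp] := h (inl (inl i)).
  have pE b : p.[b] = (val (psi b)).1 i by rewrite -hp ffunE.
  rewrite -!pE (poly_nonvanishing_const (p := p)) ?hornerC // => b.
  by rewrite pE ts_neq0.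
have [p hp] := h (inr (val (psi 0)).2).
have pE b : p.[b] = ((val (psi b)).2 == (val (psi 0)).2)%:R by rewrite -hp ffunE.
have := pE a; rewrite (poly_bool_const pE) hornerC pE eqxx => /esym.
by case: eqP => // _ /eqP; rewrite eq_sym oner_eq0.
Qed.

Lemma ts_no_Ga_subgroup : no_Ga_subgroup (ts_indGroup k D).
Proof.
move=> psi [hc hD] a; rewrite (ts_curve_const hc).
by apply: (mulgI (psi 0)); rewrite -hD addr0 mulg1.
Qed.

End ConstantCurves.

(** * Exposed facets give additive actions *)

Section Shear.
Variables (k : closedFieldType) (n : nat) (D : complex n).
Local Notation A := (sr_ring k D).
Local Notation x_ := (sr_var k D).
Variables (i : 'I_n) (S : {set 'I_n}).
Hypothesis iS : S \in exposing D i.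

Let xS : A := \prod_(j in S) x_ j.

Lemma facet_above (s : {set 'I_n}) :
  s \in faces D -> exists2 F, F \in facets D & s \subset F.
Proof.
move=> hs; have [F mF sF] := @maxset_exists _ (fun t => t \in faces D) s hs.
by exists F; rewrite // inE mF (maxsetp mF).
Qed.

(** A facet over S contains i, so adding i to a face above S gives a face. *)
Lemma exposing_face (s : {set 'I_n}) :
  S :|: s :\ i \in faces D -> s \in faces D.
Proof.
case/facet_above=> F hF sF; move: iS; rewrite inE => /and3P[_ _ /bigcapP iF].
have FD : F \in faces D by move: hF; rewrite inE => /andP[].
apply: complex_sub FD; move: sF; rewrite subUset => /andP[SF sF].
apply/subsetP=> j js; have [->|ne] := eqVneq j i.
  by apply: iF; rewrite inE hF.
by apply: (subsetP sF); rewrite !inE ne.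
Qed.

(** This is what makes x_i |-> x_i + a x^S compatible with the relations of
    k[D]: in the product over a non-face s containing i the new term vanishes. *)
Lemma exposing_prod0 (s : {set 'I_n}) : s \notin faces D ->
  xS * \prod_(j in s :\ i) x_ j = 0.
Proof.
set T := s :\ i => hs; rewrite /xS (big_setID T) /= -mulrA.
have -> : \prod_(j in S :\: T) x_ j * \prod_(j in T) x_ j =
    \prod_(j in S :|: T) x_ j.
  by rewrite [RHS](big_setID T) /= setIUl setIid setDUl setDv setU0
    (setUidPr _) ?subsetIr // mulrC.
rewrite sr_var_prod_nonface ?mulr0 //.
by apply: contra hs; exact: exposing_face.
Qed.

Definition shear_image (a : k) (j : 'I_n) : A := x_ j + (a *+ (j == i)) *: xS.

Let shear_image0 (a : k) (s : {set 'I_n}) : s \notin faces D ->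
  \prod_(j in s) shear_image a j = 0.
Proof.
move=> hs.
have [si|si] := boolP (i \in s); last first.
  rewrite -[RHS](sr_var_prod_nonface k hs); apply: eq_bigr => j js.
  rewrite /shear_image; case: eqP => [e|_]; last by rewrite scale0r addr0.
  by rewrite -e js in si.
have e : \prod_(j in s | j != i) shear_image a j = \prod_(j in s :\ i) x_ j.
  apply: eq_big => [j|j /andP[_ /negPf ne]]; first by rewrite !inE andbC.
  by rewrite /shear_image ne scale0r addr0.
rewrite (bigD1 i) //= e /shear_image eqxx mulrDl -scalerAl exposing_prod0 //.
rewrite scaler0 addr0 -[RHS](sr_var_prod_nonface k hs) [RHS](bigD1 i) //=.
by congr (_ * _); apply: eq_bigl => j; rewrite !inE andbC.
Qed.

Definition shear (a : k) : {lrmorphism A -> A} := sr_lift_hom (shear_image0 a).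

Lemma shear_var a j : shear a (x_ j) = shear_image a j.
Proof. exact: sr_lift_var. Qed.

Lemma shearDZ a c f g : shear a (f + c *: g) = shear a f + c *: shear a g.
Proof. by rewrite [LHS]raddfD; congr (_ + _); rewrite [LHS]linearZ. Qed.

(** The monomial x^S is invariant since S does not contain i. *)
Lemma shear_xS a : shear a xS = xS.
Proof.
rewrite /xS rmorph_prod /=; apply: eq_bigr => j jS.
rewrite shear_var /shear_image; case: eqP => [e|_]; last by rewrite scale0r addr0.
by move: iS; rewrite inE -e jS andbF.
Qed.

Lemma shearD a b f : shear (a + b) f = shear a (shear b f).
Proof.
apply: (@sr_hom_ext k n D (shear (a + b)) (shear a \o shear b : {lrmorphism A -> A})) => j.
rewrite [LHS]shear_var -[RHS]/(shear a (shear b (x_ j))) shear_var.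
rewrite /shear_image shearDZ shear_xS shear_var.
by rewrite /shear_image mulrnDl scalerDl addrA.
Qed.

Lemma shear0 f : shear 0 f = f.
Proof.
apply: (@sr_hom_ext k n D (shear 0) (idfun : {lrmorphism A -> A})) => j.
by rewrite shear_var /shear_image mul0rn scale0r addr0.
Qed.

Lemma shearK a : cancel (shear a) (shear (- a)).
Proof. by move=> f; rewrite -shearD addNr shear0. Qed.
Lemma shearNK a : cancel (shear (- a)) (shear a).
Proof. by move=> f; rewrite -shearD subrr shear0. Qed.

Definition shear_aut (a : k) : aut_indGroup k D :=
  SrAut (@shearK a) (@shearNK a).

Lemma shear_one_param : one_param shear_aut.
Proof.
split; last by move=> a b; apply: sr_aut_eq => f; exact: shearD.
have [d hd] := sr_deg_bound (fun o : option 'I_n => if o is Some l then x_ l else xS).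
have hd' a l : sr_deg_le d (shear a (x_ l)).
  rewrite shear_var /shear_image -[x_ l]scale1r.
  have := @sr_deg_sum _ _ _ _ [:: Some l; None] _
    (fun o => if o is Some _ then 1 else a *+ (l == i)) _ hd.
  by rewrite !big_cons big_nil addr0.
exists d => [a l|[[b l] m]]; first by split; exact: hd'.
exists ((sr_coef m (x_ l))%:P +
  (sr_coef m xS *+ (l == i))%:P * (if b then 'X else - 'X)) => a.
rewrite ffunE -[LHS]/(sr_coef m (aut_dir (shear_aut a) b (x_ l))).
have -> : aut_dir (shear_aut a) b = shear (if b then a else - a) by case: b.
rewrite shear_var /shear_image sr_coefD sr_coefZ !hornerE /=.
by congr (_ + _); case: b; rewrite ?hornerE; case: (l == i);
  rewrite ?mulr1n ?mulr0n ?mul0r // mulrC.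
Qed.

Lemma exposing_not_rigid : ~ rigid k D.
Proof.
move/rigidP/(_ _ shear_one_param 1)/(congr1 (fun g : sr_aut k D => aut_fun g (x_ i))).
rewrite /= -/(shear 1 _) shear_var /shear_image eqxx scale1r.
move/(canRL (addKr _)); rewrite addNr.
rewrite /xS -rmorph_prod prod_mpolyXE.
move/(congr1 (sr_coef [multinom nat_of_bool (j \in S) | j < n])).
rewrite sr_coef_pi sr_coef0 /mface supp_indic mcoeffX eqxx.
by move: iS; rewrite inE => /andP[-> _] /eqP; rewrite oner_eq0.
Qed.

End Shear.

Lemma fully_exposed_not_rigid (k : closedFieldType) (n : nat) (D : complex n) :
  fully_exposed D -> ~ rigid k D.
Proof.
have [F hF _] := facet_above (complex0 D).
by move/(_ F hF) => [i [S iS _]]; exact: exposing_not_rigid iS.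
Qed.

Lemma rigid_fully_hidden (k : closedFieldType) (n : nat) (D : complex n) :
  rigid k D -> fully_hidden D.
Proof. by move=> hr F _ [i [S iS _]]; exact: exposing_not_rigid iS hr. Qed.

(** * A rigid example: the union of the coordinate axes *)

Section Discrete.
Variables (n : nat) (n_gt0 : (0 < n)%N).

Let small_sub (s t : {set 'I_n}) : s \subset t ->
  t \in [set u : {set 'I_n} | (#|u| <= 1)%N] ->
  s \in [set u : {set 'I_n} | (#|u| <= 1)%N].
Proof. by move=> /subset_leq_card st; rewrite !inE; exact: leq_trans. Qed.

Let small_vertex (i : 'I_n) : [set i] \in [set u : {set 'I_n} | (#|u| <= 1)%N].
Proof. by rewrite inE cards1. Qed.

Definition discrete_complex : complex n := Complex n_gt0 small_sub small_vertex.

(** The monomials surviving in k[D] are the powers of single variables. *)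
Lemma mface_discrete m :
  mface discrete_complex m <-> exists j, m = (U_(j) *+ m j)%MM.
Proof.
rewrite /mface inE; split=> [h|[j ->]]; last first.
  rewrite -(cards1 j) subset_leq_card //; apply/subsetP=> l.
  by rewrite !inE mulmnE mnm1E; have [->|] := eqVneq j l; rewrite ?eqxx.
have [j hj] : exists j, forall l, l != j -> m l = 0%N.
  have [e|[j hj]] := set_0Vmem [set i | m i != 0%N].
    exists (Ordinal n_gt0) => l _; apply/eqP; apply: contraT => ml.
    by have := in_set0 l; rewrite -e inE ml.
  exists j => l ne; apply/eqP; apply: contraT => ml.
  have /card_le1P/(_ j hj l) := h.
  by rewrite !inE ml (negPf ne).
exists j; apply/mnmP=> l; rewrite mulmnE mnm1E [_ == l]eq_sym.
by case: eqP => [->|/eqP/hj ->]; rewrite ?mul1n.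
Qed.

Section Axes.
Variable k : closedFieldType.
Local Notation A := (sr_ring k discrete_complex).
Local Notation x_ := (sr_var k discrete_complex).

(** The restriction of functions to the j-th axis, which reads off the
    coefficients of the powers of x_j. *)
Lemma axis_ex (j : 'I_n) : exists ax : {rmorphism A -> {poly k}},
  [/\ forall i, ax (x_ i) = if i == j then 'X else 0,
      forall c : k, ax c%:A = c%:P &
      forall f e, (ax f)`_e = sr_coef (U_(j) *+ e)%MM f].
Proof.
pose y (i : 'I_n) : {poly k} := if i == j then 'X else 0.
have y0 (s : {set 'I_n}) : s \notin faces discrete_complex -> \prod_(i in s) y i = 0.
  rewrite inE -ltnNge => /card_gt1P[a [b [sa sb ab]]].
  have [l sl nl] : exists2 l, l \in s & l != j.
    by have [e|] := eqVneq a j; [exists b; rewrite // -e eq_sym|exists a].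
  by rewrite (bigD1 l) //= /y (negPf nl) mul0r.
have [ax [axx axc axE]] := sr_lift_to (polyC : {rmorphism k -> {poly k}}) y0.
exists ax; split=> // f e; rewrite -[f]sr_reprK axE sr_coef_pi.
have -> : mface discrete_complex (U_(j) *+ e)%MM.
  by apply/mface_discrete; exists j; rewrite mulmnE mnm1E eqxx mul1n.
rewrite {2}[repr f]mpolyE linear_sum coef_sum /=; apply: eq_bigr => m _.
rewrite mcoeffZ mcoeffX coefCM; congr (_ * _).
have [h|] := boolP [exists l, (l != j) && (m l != 0%N)].
  have [l /andP[nl ml]] := existsP h.
  rewrite /mmap1 (bigD1 l) //= /y (negPf nl) expr0n (negPf ml) mul0r coef0.
  case: eqP => // em; move: ml; rewrite em mulmnE mnm1E [_ == l]eq_sym (negPf nl).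
  by rewrite mul0n.
rewrite negb_exists => /forallP h.
have hm : m = (U_(j) *+ m j)%MM.
  apply/mnmP=> l; rewrite mulmnE mnm1E [_ == l]eq_sym; have := h l.
  by case: eqP => [->|] _ /=; rewrite ?mul1n // negbK => /eqP->.
have -> : mmap1 y m = 'X^(m j).
  rewrite /mmap1 (bigD1 j) //= {1}/y eqxx big1 ?mulr1 // => l nl.
  by have := h l; rewrite nl negbK => /eqP->; rewrite expr0.
rewrite coefXn; congr (nat_of_bool _)%:R.
apply/eqP/eqP => [->//|em]; have := congr1 (fun m : 'X_{1..n} => m j) em.
by rewrite mulmnE mnm1E eqxx mul1n => ->.
Qed.

Lemma sr_var_discrete (i j : 'I_n) : i != j -> x_ i * x_ j = 0.
Proof.
move=> ne; have nf : [set i; j] \notin faces discrete_complex.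
  by rewrite inE cards2 ne.
by have := sr_var_prod_nonface k nf; rewrite big_setU1 ?inE //= big_set1.
Qed.

Lemma discrete_rigid : (1 < n)%N -> rigid k discrete_complex.
Proof.
move=> n_gt1 rho rhoG; have /choice[ax hax] := axis_ex.
have axx j i : ax j (x_ i) = if i == j then 'X else 0 by have [-> _ _] := hax j.
have axc j (c : k) : ax j c%:A = c%:P by have [_ -> _] := hax j.
have axE j f e : (ax j f)`_e = sr_coef (U_(j) *+ e)%MM f by have [_ _ ->] := hax j.
have off a i j : i != j -> ax j (ga_point rho a (x_ i)) = 0.
  (* The product rho(x_i) rho(x_j) = 0 restricts to the domain k[x][t], where the
     second factor is nonzero since it is x at t = 0. *)
  move=> ne; have /eqP : map_poly (ax j) (rho (x_ i) * rho (x_ j)) = 0.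
    by rewrite -(rmorphM rho) sr_var_discrete // !raddf0.
  rewrite rmorphM mulf_eq0 => /orP[]/eqP e0.
    by rewrite /ga_point -horner_map /= e0 horner0.
  have := congr1 (fun p => p.[ax j 0]) e0.
  have [_ r0 _] := rhoG; rewrite horner0 horner_map r0 axx eqxx => /eqP.
  by rewrite polyX_eq0.
have line a i : exists2 c, c != 0 & ax i (ga_point rho a (x_ i)) = c *: 'X.
  pose R b := ax i (ga_point rho b (x_ i)).
  (* The constant term is the value at the origin, which lies on another axis,
     where the image of x_i vanishes. *)
  have R0 : (R a)`_0 = 0.
    have [j ne] : exists j, i != j.
      apply: contrapT => h; move: n_gt1; rewrite -{1}(card_ord n) ltnNge => /negP[].
      rewrite -cardsT -(cards1 i) subset_leq_card //; apply/subsetP=> j _.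
      by rewrite inE; apply: contraT => ne; case: h; exists j; rewrite eq_sym.
    by rewrite axE mulm0n -(mulm0n U_(j)) -axE off ?coef0.
  (* The automorphisms at a and - a are inverse to each other, and both preserve
     the i-th axis; so R a has degree 1. *)
  have RK : R a \Po R (- a) = 'X.
    pose e1 : {rmorphism A -> {poly k}} := ax i \o ga_point rho (- a).
    pose e2 : {rmorphism A -> {poly k}} := comp_poly (R (- a)) \o ax i.
    have e12 : e1 =1 e2.
      apply: sr_rmorph_ext => [c|j] /=.
        have [rc _ _] := rhoG.
        by rewrite /ga_point rc hornerC !axc comp_polyC.
      rewrite axx; have [->|ne] := eqVneq j i; first by rewrite comp_polyX.
      by rewrite off // comp_poly0.
    have := e12 (ga_point rho a (x_ i)).
    by rewrite /= ga_pointK // axx eqxx.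
  have : ((size (R a)).-1 * (size (R (- a))).-1)%N = 1%N.
    by rewrite -size_comp_poly RK size_polyX.
  move/eqP; rewrite muln_eq1 => /andP[/eqP sR _].
  have {}sR : size (R a) = 2%N by case: (size (R a)) sR => //= u ->.
  exists (R a)`_1; first by rewrite -[1%N]/(2.-1) -sR lead_coef_eq0 -size_poly_eq0 sR.
  rewrite -/(R a) -[LHS]coefK sR poly_def !big_ord_recl big_ord0 /=.
  by rewrite R0 scale0r add0r addr0 expr1.
have fixed a i : ga_point rho a (x_ i) = x_ i.
  have line1 b : ax i (ga_point rho b (x_ i)) = 'X.
    have [c _ e] := line b i; rewrite e.
    (* The slope c is a polynomial in b without zeros, and is 1 at b = 0. *)
    pose p := map_poly (sr_coef (U_(i) *+ 1)%MM) (rho (x_ i)).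
    have pE d : p.[d] = (ax i (ga_point rho d (x_ i)))`_1.
      by rewrite axE sr_coef_horner.
    have p0 : p = (p.[0])%:P.
      apply: poly_nonvanishing_const => d; rewrite pE; have [u nu ->] := line d i.
      by rewrite coefZ coefX mulr1.
    have : p.[b] = 1 by rewrite p0 hornerC pE ga_point0 // axx eqxx coefX.
    by rewrite pE e coefZ coefX mulr1 => ->; rewrite scale1r.
  apply: sr_coef_inj => m; have [|nm] := boolP (mface discrete_complex m); last first.
    by rewrite !sr_coef_nonface.
  case/mface_discrete=> j ->; rewrite -!axE; congr (_`_ _).
  have [->|ne] := eqVneq j i; first by rewrite line1 axx eqxx.
  by rewrite off 1?eq_sym // axx eq_sym (negPf ne).
move=> f; apply/eqP; rewrite -subr_eq0; apply/eqP/sr_poly_fun_eq0 => a.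
rewrite hornerD hornerN hornerC -/(ga_point rho a f).
have -> : ga_point rho a f = f; last by rewrite subrr.
pose u : {rmorphism A -> A} := ga_point rho a.
apply: (@sr_rmorph_ext _ _ _ _ u idfun) => [c|i]; last exact: fixed.
by have [rc _ _] := rhoG; rewrite /= /ga_point rc hornerC.
Qed.

End Axes.
End Discrete.

(** * Comparison of the automorphism ind-groups *)

Theorem mainTheorem5 (k : closedFieldType) (char0 : [pchar k] =i pred0) :
  (forall (n n' : nat) (D : complex n) (D' : complex n'),
      rigid k D -> ~ rigid k D' ->
      ~ ind_isomorphic (aut_indGroup k D) (aut_indGroup k D')) /\
  (forall (n : nat) (D : complex n),
      ind_isomorphic (aut_indGroup k D) (ts_indGroup k D) -> fully_hidden D) /\
  ~ (exists Phi : forall (n : nat) (D : complex n),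
                    rigid k D -> {m : nat & complex m},
      forall (n : nat) (D : complex n) (rD : rigid k D),
        fully_exposed (projT2 (Phi n D rD)) /\
        ind_isomorphic (aut_indGroup k (projT2 (Phi n D rD)))
                       (aut_indGroup k D)).
Proof.
have rigid_iso n n' (D : complex n) (D' : complex n') :
    ind_isomorphic (aut_indGroup k D') (aut_indGroup k D) ->
    rigid k D -> rigid k D'.
  by move=> iso /rigidP hD; apply/rigidP; exact: no_Ga_subgroup_iso iso hD.
split; [|split].
- by move=> n n' D D' rD nrD' /ind_isomorphic_sym/rigid_iso/(_ rD).
- move=> n D iso; apply: (@rigid_fully_hidden k); apply/rigidP.
  by apply: no_Ga_subgroup_iso iso _; exact: ts_no_Ga_subgroup.
case=> Phi hPhi.
have rD : rigid k (@discrete_complex 2 isT) by exact: discrete_rigid.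
have [ex iso] := hPhi _ _ rD.
exact: (fully_exposed_not_rigid ex) (rigid_iso _ _ _ _ iso rD).
Qed.
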